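(* Let $\Gamma,\Lambda$ be two countable groups, where $\Lambda$ is infinite and amenable, and let $\mathfrak{U}$ be any family of finite-dimensional unitary groups equipped with bi-invariant submultiplicative norms. Then the restricted wreath product $\Gamma\wr\Lambda$ is uniformly $\mathfrak{U}$-stable, with a linear estimate.
   Context: The *lamplighter* (restricted wreath product) is $\Gamma\wr\Lambda=(\bigoplus_\Lambda\Gamma)\rtimes\Lambda$, where $\Lambda$ acts by shifting the coordinates. **Stability.** All groups are discrete and countable; $\omega$ is a fixed non-principal ultrafilter on $\mathbb{N}=\{0,1,2,\dots\}$. $\mathfrak{U}$ is a family of pairs $(U(k),\|\cdot\|)$, where $U(k)$ is the group of $k\times k$ unitary matrices and $\|\cdot\|$ is a norm on $k\times k$ complex matrices that is submultiplicative ($\|AB\|\le\|A\|\|B\|$) and bi-invariant ($\|uAv\|=\|A\|$ for $u,v\in U(k)$); the same $U(k)$ may occur several times with different norms. For a group $G$ and maps $\phi,\psi:G\to U(k)$ put $\operatorname{def}(\phi)=\sup_{g,h\in G}\|\phi(gh)-\phi(g)\phi(h)\|$ and $\operatorname{dist}(\phi,\psi)=\sup_{g\in G}\|\phi(g)-\psi(g)\|$. A *uniform asymptotic homomorphism* $\phi:G\to\mathfrak{U}$ is a sequence of maps $\phi_n:G\to U(k_n)$, with $(U(k_n),\|\cdot\|)\in\mathfrak{U}$, such that $\operatorname{def}(\phi_n)\to 0$. $G$ is *uniformly $\mathfrak{U}$-stable* if for every uniform asymptotic homomorphism $(\phi_n)$ there are homomorphisms $\psi_n:G\to U(k_n)$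 with $\operatorname{dist}(\phi_n,\psi_n)\to 0$. It is *uniformly $\mathfrak{U}$-stable with a linear estimate* if for every uniform asymptotic homomorphism $(\phi_n)$ there are homomorphisms $\psi_n:G\to U(k_n)$ with $\operatorname{dist}(\phi_n,\psi_n)=O_\omega(\operatorname{def}(\phi_n))$, i.e. there are $C\ge 0$ and $S\in\omega$ such that $\operatorname{dist}(\phi_n,\psi_n)\le C\operatorname{def}(\phi_n)$ for all $n\in S$. *)

(* Defs.v *)
From HB Require Import structures.
From mathcomp Require Import all_boot all_order all_algebra.
From mathcomp Require Import finmap complex.
From mathcomp Require Import all_classical all_reals all_analysis.

Set Implicit Arguments.
Unset Strict Implicit.
Unset Printing Implicit Defensive.

Import Order.TTheory GRing.Theory Num.Theory.
Import numFieldNormedType.Exports.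

Local Open Scope classical_set_scope.
Local Open Scope ring_scope.

Section RestrictedWreathProduct.
Variables (Gam Lam : groupType).
Local Open Scope group_scope.

Definition lamps := {fsfun Lam -> Gam with 1}.

Definition lamp_one : lamps := [fsfun with 1].

Definition lamp_mul (f g : lamps) : lamps :=
  [fsfun x in (finsupp f `|` finsupp g)%fset => f x * g x].

Definition lamp_inv (f : lamps) : lamps :=
  [fsfun x in finsupp f => (f x)^-1].

Definition lamp_shift (a : Lam) (f : lamps) : lamps :=
  [fsfun x in [fset a * y | y in finsupp f]%fset => f (a^-1 * x)].

Lemma lamp_oneE x : lamp_one x = 1.
Proof. by rewrite /lamp_one fsfunE. Qed.

Lemma lamp_mulE f g x : lamp_mul f g x = f x * g x.
Proof.
rewrite /lamp_mul fsfunE; case: ifPn => //.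
by rewrite in_fsetU negb_or => /andP[/fsfun_dflt -> /fsfun_dflt ->]; rewrite mulg1.
Qed.

Lemma lamp_invE f x : lamp_inv f x = (f x)^-1.
Proof. by rewrite /lamp_inv fsfunE; case: finsuppP => //; rewrite invg1. Qed.

Lemma lamp_shiftE a f x : lamp_shift a f x = f (a^-1 * x).
Proof.
rewrite /lamp_shift fsfunE; case: ifPn => // /negP xS.
rewrite fsfun_dflt //; apply/negP => fx; apply: xS.
by apply/imfsetP; exists (a^-1 * x); rewrite ?mulVKg.
Qed.

(* An alias, so that the product type does not pick up any other group law. *)
Definition wreath : Type := (lamps * Lam)%type.
HB.instance Definition _ := Choice.copy wreath (lamps * Lam)%type.

Definition wr_one : wreath := (lamp_one, 1).
Definition wr_mul (u v : wreath) : wreath :=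
  (lamp_mul u.1 (lamp_shift u.2 v.1), u.2 * v.2).
Definition wr_inv (u : wreath) : wreath :=
  (lamp_shift u.2^-1 (lamp_inv u.1), u.2^-1).

Let lampE := (lamp_mulE, lamp_shiftE, lamp_invE, lamp_oneE).

Lemma wr_mulA : associative wr_mul.
Proof.
move=> [f a] [g b] [h c]; congr pair => /=; last by rewrite mulgA.
by apply/fsfunP => x; rewrite !lampE invgM !mulgA.
Qed.

Lemma wr_mul1 : left_id wr_one wr_mul.
Proof.
move=> [f a]; congr pair => /=; last by rewrite mul1g.
by apply/fsfunP => x; rewrite !lampE invg1 !mul1g.
Qed.

Lemma wr_mulr1 : right_id wr_one wr_mul.
Proof.
move=> [f a]; congr pair => /=; last by rewrite mulg1.
by apply/fsfunP => x; rewrite !lampE mulg1.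
Qed.

Lemma wr_mulV : left_inverse wr_one wr_inv wr_mul.
Proof.
move=> [f a]; congr pair => /=; last by rewrite mulVg.
by apply/fsfunP => x; rewrite !lampE mulVg.
Qed.

Lemma wr_mulrV : right_inverse wr_one wr_inv wr_mul.
Proof.
move=> [f a]; congr pair => /=; last by rewrite mulgV.
by apply/fsfunP => x; rewrite !lampE invgK mulVKg mulgV.
Qed.

HB.instance Definition _ :=
  isGroup.Build wreath wr_mulA wr_mul1 wr_mulr1 wr_mulV wr_mulrV.

End RestrictedWreathProduct.

(* Existence of a left-invariant mean on l^infty(G); [m] is only constrained
   on bounded functions. *)
Definition amenable (R : realType) (G : groupType) : Prop :=
  exists m : (G -> R) -> R,
    [/\ m (cst 1) = 1,
        forall f : G -> R, bounded_fun f -> (forall x, 0 <= f x) -> 0 <= m f,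
        forall (a : R) (f g : G -> R), bounded_fun f -> bounded_fun g ->
          m (fun x => a * f x + g x) = a * m f + m g
      & forall (a : G) (f : G -> R), bounded_fun f ->
          m (fun x => f (a^-1 * x)%g) = m f].

Record is_unitary_norm (R : realType) (k : nat) (N : 'M[R[i]]_k -> R) : Prop :=
  IsUnitaryNorm {
    unorm_ge0 : forall A, 0 <= N A;
    unorm_eq0 : forall A, N A = 0 -> A = 0;
    unormZ : forall (a : R[i]) A, N (a *: A) = Normc.normc a * N A;
    unormD : forall A B, N (A + B) <= N A + N B;
    unormM : forall A B, N (A *m B) <= N A * N B;
    unorm_biinv : forall u A v, u \is unitarymx -> v \is unitarymx ->
      N (u *m A *m v) = N A
  }.

(* A pair (U(k), ||.||), stored as the dimension k and the norm. *)
Record normed_unitary (R : realType) := NormedUnitary {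
  nu_dim : nat;
  nu_norm : 'M[R[i]]_nu_dim -> R;
  nu_normP : is_unitary_norm nu_norm
}.

Section Stability.
Variables (R : realType) (G : groupType).
Implicit Types (V : normed_unitary R).

Definition unitary_map V (phi : G -> 'M[R[i]]_(nu_dim V)) : Prop :=
  forall g, phi g \is unitarymx.

Definition unitary_hom V (phi : G -> 'M[R[i]]_(nu_dim V)) : Prop :=
  unitary_map phi /\ forall g h, phi (g * h)%g = phi g *m phi h.

(* By bi-invariance every unitary matrix has the norm of the identity, so for
   unitary maps both suprema below are over nonempty bounded sets of reals. *)
Definition defect V (phi : G -> 'M[R[i]]_(nu_dim V)) : R :=
  sup (range (fun p : G * G =>
    nu_norm (phi (p.1 * p.2)%g - phi p.1 *m phi p.2))).

Definition udist V (phi psi : G -> 'M[R[i]]_(nu_dim V)) : R :=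
  sup (range (fun g => nu_norm (phi g - psi g))).

Definition uniform_asymptotic_hom (U : set (normed_unitary R))
    (V : nat -> normed_unitary R)
    (phi : forall n, G -> 'M[R[i]]_(nu_dim (V n))) : Prop :=
  [/\ forall n, U (V n), forall n, unitary_map (phi n)
    & (fun n => defect (phi n)) @ \oo --> (0 : R)].

Definition uniformly_stable_linear (omega : set_system nat)
    (U : set (normed_unitary R)) : Prop :=
  forall (V : nat -> normed_unitary R)
         (phi : forall n, G -> 'M[R[i]]_(nu_dim (V n))),
  uniform_asymptotic_hom U phi ->
  exists2 psi : forall n, G -> 'M[R[i]]_(nu_dim (V n)),
    forall n, unitary_hom (psi n) &
    exists (C : R) (S : set nat), [/\ 0 <= C, omega S &
      forall n, S n -> udist (phi n) (psi n) <= C * defect (phi n)].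

End Stability.

(* Main.v *)
Require Import Defs.
From mathcomp Require Import all_boot all_order all_algebra.
From mathcomp Require Import finmap complex ring lra.
From mathcomp Require Import all_classical all_reals all_analysis.
From mathcomp Require Import wochoice.

(* Let [phi] be an approximate homomorphism of [Gam wr Lam] to [U(k)], and let
   [t -> infinity] along a non-principal ultrafilter of [Lam].  The iterated limits of
   [phi (t1.a1 * ... * tn.an)] do not depend on the slots [t1, ..., tn], and lamp
   configurations in different slots commute; hence they define an approximate
   homomorphism on the free commutative monoid over the lamp group.  This monoid is
   amenable, so Kazhdan's averaging argument gives a homomorphism [theta] of it near the
   limits, a family of commuting unitaries.  Since [(ab)_1...(ab)_n] is the product of
   [a_1...a_n] and [b_1...b_n], the powers [theta(ab)^n] and [theta(a)^n theta(b)^n] stay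
   close for all [n], and as there are no small subgroups in [U(k)], [theta] is a
   homomorphism on the lamp group.  Conjugated by the limit of [phi t], it is close to
   [phi] on the lamps.  So up to a linear error [phi] factors through the quotient of the
   wreath product by the kernel of [theta], an extension of an abelian group by [Lam];
   this quotient is amenable and the averaging argument applies a second time. *)

Set Implicit Arguments.
Unset Strict Implicit.
Unset Printing Implicit Defensive.

Import Order.TTheory GRing.Theory Num.Theory.
Import numFieldNormedType.Exports.

Local Open Scope classical_set_scope.
Local Open Scope ring_scope.

(** * Means and ultrafilter limits *)

Section Means.
Variable R : realType.

Definition bounded_real (S : Type) (f : S -> R) := exists c, forall s, `|f s| <= c.

Record is_mean (S : Type) (m : (S -> R) -> R) : Prop := IsMean {
  mean1 : m (fun=> 1) = 1;
  mean_ge0 : forall f, bounded_real f -> (forall s, 0 <= f s) -> 0 <= m f;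
  mean_lin : forall a f g, bounded_real f -> bounded_real g ->
    m (fun s => a * f s + g s) = a * m f + m g
}.

Section Bounded.
Variable S : Type.
Implicit Types f g : S -> R.

Lemma bounded_real_cst a : bounded_real (fun _ : S => a).
Proof. by exists `|a| => s. Qed.

Lemma bounded_realM f g : bounded_real f -> bounded_real g ->
  bounded_real (fun s => f s * g s).
Proof.
move=> [b fb] [c gc]; exists (b * c) => s.
by rewrite normrM ler_pM.
Qed.

Lemma bounded_realD f g : bounded_real f -> bounded_real g ->
  bounded_real (fun s => f s + g s).
Proof.
move=> [b fb] [c gc]; exists (b + c) => s.
by rewrite (le_trans (ler_normD _ _)) ?lerD.
Qed.

Lemma bounded_realZ a f : bounded_real f -> bounded_real (fun s => a * f s).
Proof. by move=> fb; apply: bounded_realM => //; exact: bounded_real_cst. Qed.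

Lemma bounded_realN f : bounded_real f -> bounded_real (fun s => - f s).
Proof. by move=> [c fc]; exists c => s; rewrite normrN. Qed.

Lemma bounded_realB f g : bounded_real f -> bounded_real g ->
  bounded_real (fun s => f s - g s).
Proof. by move=> fb gb; apply: bounded_realD => //; exact: bounded_realN. Qed.

Lemma bounded_real_sum (I : Type) (r : seq I) (F : I -> S -> R) :
  (forall i, bounded_real (F i)) -> bounded_real (fun s => \sum_(i <- r) F i s).
Proof.
move=> Fb; elim: r => [|i r IH].
  under eq_fun do rewrite big_nil.
  exact: bounded_real_cst.
under eq_fun do rewrite big_cons.
exact: bounded_realD.
Qed.

Lemma bounded_real_comp (T : Type) (h : T -> S) f :
  bounded_real f -> bounded_real (fun t => f (h t)).
Proof. by move=> [c fc]; exists c => t. Qed.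

End Bounded.
#[local] Hint Resolve bounded_real_cst bounded_realM bounded_realD bounded_realN
  bounded_realB bounded_realZ bounded_real_comp : core.

Section MeanTheory.
Variables (S : Type) (m : (S -> R) -> R).
Hypothesis mP : is_mean m.
Implicit Types f g : S -> R.

Lemma mean0 : m (fun=> 0) = 0.
Proof.
have /= := mean_lin mP 1 (bounded_real_cst S 0) (bounded_real_cst S 0).
under [X in m X]eq_fun do rewrite mul1r addr0.
by rewrite mul1r => /eqP; rewrite -subr_eq0 opprD addNKr oppr_eq0 => /eqP.
Qed.

Lemma meanZ a f : bounded_real f -> m (fun s => a * f s) = a * m f.
Proof.
move=> fb; have /= := mean_lin mP a fb (bounded_real_cst S 0).
under [X in m X]eq_fun do rewrite addr0.
by rewrite mean0 addr0.
Qed.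

Lemma mean_cst a : m (fun=> a) = a.
Proof.
rewrite -[RHS]mulr1 -[in RHS](mean1 mP) -meanZ //.
by under [in RHS]eq_fun do rewrite mulr1.
Qed.

Lemma meanD f g : bounded_real f -> bounded_real g ->
  m (fun s => f s + g s) = m f + m g.
Proof.
move=> fb gb; rewrite -[X in X + _]mul1r -(mean_lin mP) //.
by under [in RHS]eq_fun do rewrite mul1r.
Qed.

Lemma meanN f : bounded_real f -> m (fun s => - f s) = - m f.
Proof.
move=> fb; rewrite -mulN1r -meanZ //.
by under [in RHS]eq_fun do rewrite mulN1r.
Qed.

Lemma meanB f g : bounded_real f -> bounded_real g ->
  m (fun s => f s - g s) = m f - m g.
Proof. by move=> fb gb; rewrite meanD ?meanN//; exact: bounded_realN. Qed.

Lemma mean_sum (I : Type) (r : seq I) (F : I -> S -> R) :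
  (forall i, bounded_real (F i)) ->
  m (fun s => \sum_(i <- r) F i s) = \sum_(i <- r) m (F i).
Proof.
move=> Fb; elim: r => [|i r IH].
  by rewrite big_nil; under eq_fun do rewrite big_nil; rewrite mean0.
rewrite big_cons; under eq_fun do rewrite big_cons.
by rewrite meanD ?IH//; exact: bounded_real_sum.
Qed.

Lemma ler_mean f g : bounded_real f -> bounded_real g ->
  (forall s, f s <= g s) -> m f <= m g.
Proof.
move=> fb gb fg; rewrite -subr_ge0 -meanB //.
by apply: (mean_ge0 mP) => [|s]; [exact: bounded_realB|rewrite subr_ge0].
Qed.

Lemma mean_norm f c : (forall s, `|f s| <= c) -> `|m f| <= c.
Proof.
move=> fc; have fb : bounded_real f by exists c.
rewrite ler_norml -(mean_cst (- c)) -[X in _ && (_ <= X)](mean_cst c).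
by apply/andP; split; apply: ler_mean => // s; have := fc s; rewrite ler_norml => /andP[].
Qed.

(** The weights are the measures that [m] gives to the fibres of [r]. *)
Lemma meanE_fin (T : finType) (r : S -> T) (F : T -> R) :
  m (fun s => F (r s)) = \sum_t m (fun s => (r s == t)%:R) * F t.
Proof.
have bt t : bounded_real (fun s => (r s == t)%:R : R).
  by exists 1 => s; case: (_ == _); rewrite ?normr1 ?normr0.
transitivity (m (fun s => \sum_t F t * (r s == t)%:R)).
  congr m; apply/funext => s.
  by rewrite (bigD1 (r s)) //= eqxx mulr1 big1 ?addr0 // => t /negPf tr; rewrite eq_sym tr mulr0.
rewrite mean_sum; last by move=> t; exact: bounded_realZ.
by apply: eq_bigr => t _; rewrite meanZ // mulrC.
Qed.

(* Partition [S] into finitely many pieces on which every [h j] oscillates by at most [e]. *)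
Lemma mean_approx (J : finType) (h : J -> S -> R) (e : R) :
  (forall j, bounded_real (h j)) -> 0 < e -> exists (T : finType) (w : T -> R) (p : T -> S),
  [/\ forall t, 0 <= w t, \sum_t w t = 1 &
      forall j, `|m (h j) - \sum_t w t * h j (p t)| <= e].
Proof.
move=> hb e0; have [c hc] : exists c, forall j s, `|h j s| <= c.
  pose c j : R := xget 0 [set b : R | forall s, `|h j s| <= b].
  have cP j s : `|h j s| <= c j.
    rewrite /c; case: xgetP => [y -> //|no].
    by have [b hjb] := hb j; case: (no b).
  have c0 j (s : S) : 0 <= c j := le_trans (normr_ge0 _) (cP j s).
  exists (\sum_j c j) => j s; rewrite (le_trans (cP j s)) //.
  by rewrite (bigD1 j) //= ler_wpDr // sumr_ge0 // => i _; exact: c0 s.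
pose N := Num.trunc ((c + c) / e).
pose r s : {ffun J -> 'I_N.+1} := [ffun j => inord (Num.trunc ((h j s + c) / e))].
have [[s0]|noS] := pselect (inhabited S); last first.
  have : m (fun=> 0) = m (fun=> 1) by congr m; apply/funext => s; case: noS; constructor.
  by rewrite mean0 (mean1 mP) => /eqP; rewrite eq_sym oner_eq0.
(* Empty cells get the default point [s0]; their weight is zero. *)
pose p t := if pselect (exists s, r s = t) is left ex then projT1 (cid ex) else s0.
have rp s : r (p (r s)) = r s.
  by rewrite /p; case: pselect => [ex|[]]; [exact: (projT2 (cid ex))|exists s].
have hr s s' j : r s = r s' -> `|h j s - h j s'| <= e.
  move=> /ffunP/(_ j); rewrite !ffunE => /(congr1 val) /=.
  have hcb u : 0 <= (h j u + c) / e /\ (Num.trunc ((h j u + c) / e) < N.+1)%N.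
    have := hc j u; rewrite ler_norml => /andP[h1 h2]; split.
      by rewrite divr_ge0 ?(ltW e0) //; lra.
    by rewrite ltnS le_truncn // ler_pM2r ?invr_gt0 // lerD2r.
  rewrite !inordK ?(hcb _).2 // => trE.
  have := truncn_itv (hcb s).1; have := truncn_itv (hcb s').1; rewrite trE.
  rewrite -natr1 !ler_pdivlMr // !ltr_pdivrMr // => /andP[a1 a2] /andP[b1 b2].
  by rewrite ler_norml; apply/andP; split; nra.
exists {ffun J -> 'I_N.+1}, (fun t => m (fun s => (r s == t)%:R)), p; split.
- move=> t; apply: (mean_ge0 mP) => [|s]; last by case: (_ == _).
  by exists 1 => s; case: (_ == _); rewrite ?normr1 ?normr0.
- have := meanE_fin r (fun=> 1); rewrite (mean1 mP) => E; rewrite [RHS]E.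
  by apply: eq_bigr => t _; rewrite mulr1.
- move=> j; rewrite -(meanE_fin r (fun t => h j (p t))) -meanB //.
    by apply: mean_norm => s; apply: hr; rewrite rp.
  exact: (@bounded_real_comp S S (fun s => p (r s))).
Qed.

End MeanTheory.

(** Ultrafilter limits satisfy this, averages in general do not. It allows passing to the limit in a
    product of two functions of the same variable. *)
Definition is_mult_mean (S : Type) (m : (S -> R) -> R) := is_mean m /\
  forall f g, bounded_real f -> bounded_real g -> m (fun s => f s * g s) = m f * m g.

Section UltraLimit.
Variables (T : Type) (F : set_system T).
Hypothesis FU : UltraFilter F.
Implicit Types f g : T -> R.

Definition ulim f : R := lim (f t @[t --> F]).

(** Compactness of [[-c, c]] gives a cluster point, and a cluster point of an ultrafilter is a
    limit. *)
Lemma ulim_cvg f : bounded_real f -> f t @[t --> F] --> ulim f.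
Proof.
move=> [c fc]; apply/cvg_ex => /=.
have [|l [_ fl]] := @segment_compact R (- c) c (f t @[t --> F]) _.
  by apply: (@filterE _ F) => t /=; rewrite in_itv /= -ler_norml.
exists l => U lU; have [//|FU'] := in_ultra_setVsetC (f @^-1` U) FU.
by have [x []] := fl (~` U) U FU' lU.
Qed.

Lemma ulim_eq f l : f t @[t --> F] --> l -> ulim f = l.
Proof. by move=> fl; apply: cvg_lim fl. Qed.

Lemma ulim_near f g : bounded_real g -> (\forall t \near F, f t = g t) -> ulim f = ulim g.
Proof.
move=> gb fg; apply: ulim_eq; apply: cvg_trans (ulim_cvg gb).
by apply: near_eq_cvg; apply: filterS fg => t ->.
Qed.

Lemma ulim_mult : is_mult_mean ulim.
Proof.
split; first split.
- by apply: ulim_eq; exact: cvg_cst.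
- move=> f fb f0; apply: limr_ge; last exact: nearW.
  by apply/cvg_ex; exists (ulim f); exact: ulim_cvg.
- move=> a f g fb gb; apply: ulim_eq; apply: cvgD; last exact: ulim_cvg.
  by apply: cvgM; [exact: cvg_cst|exact: ulim_cvg].
- by move=> f g fb gb; apply: ulim_eq; apply: cvgM; exact: ulim_cvg.
Qed.

End UltraLimit.

End Means.

(** * Means invariant under commuting maps *)

Section CommutingMean.
Variable R : realType.

Lemma exists_ultra_eventually : exists2 F : set_system nat, UltraFilter F & \oo `<=` F.
Proof. by have [F []] := ultraFilterLemma eventually_filter; exists F. Qed.

(** Take an ultrafilter limit of Cesàro averages: the shift changes the average [A f n] by
    [(f n.+1 - f 0) / n.+1], which tends to zero. *)
Lemma shift_invariant_mean : exists2 m : (nat -> R) -> R, is_mean m &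
  forall f, bounded_real f -> m (fun n => f n.+1) = m f.
Proof.
have [F FU Foo] := exists_ultra_eventually.
have [LM LMM] := ulim_mult R FU.
pose A (f : nat -> R) n := n.+1%:R^-1 * \sum_(i < n.+1) f i.
have A_norm f c : (forall n, `|f n| <= c) -> forall n, `|A f n| <= c.
  move=> fc n; rewrite normrM ger0_norm ?invr_ge0 // mulrC ler_pdivrMr ?ltr0n //.
  rewrite (le_trans (ler_norm_sum _ _ _)) //.
  apply: (@le_trans _ _ (\sum_(i < n.+1) c)); first exact: ler_sum.
  by rewrite sumr_const card_ord mulr_natr.
have A_bounded f : bounded_real f -> bounded_real (A f).
  by move=> [c fc]; exists c; exact: A_norm.
exists (fun f => ulim F (A f)); first split.
- rewrite -[RHS](mean1 LM); congr ulim; apply/funext => n.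
  by rewrite /A sumr_const card_ord mulVf.
- move=> f fb f0; apply: (mean_ge0 LM) => [|n]; first exact: A_bounded.
  by rewrite mulr_ge0 ?invr_ge0 // sumr_ge0.
- move=> a f g fb gb; rewrite -(mean_lin LM); try exact: A_bounded.
  congr ulim; apply/funext => n.
  by rewrite /A big_split /= -mulr_sumr mulrDr mulrCA.
- move=> f [c fc]; apply/eqP; rewrite -subr_eq0 -(meanB LM); last 2 first.
  + by apply: A_bounded; exists c.
  + by apply: A_bounded; exists c.
  have -> : (fun n => A (fun i => f i.+1) n - A f n) =
            (fun n => (f n.+1 - f 0%N) * n.+1%:R^-1).
    apply/funext => n; rewrite /A -mulrBr mulrC big_ord_recr big_ord_recl /=.
    by congr (_ / _); rewrite addrC opprD addrACA subrr addr0.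
  have bh : bounded_real (fun n => (n.+1%:R)^-1 : R).
    by exists 1 => n; rewrite ger0_norm ?invr_ge0 // invf_le1 ?ltr0n // ler1n.
  rewrite LMM //; last first.
    by exists (c + c) => n; rewrite (le_trans (ler_normB _ _)) ?lerD.
  rewrite [X in _ * X](@ulim_eq _ _ _ FU _ 0) ?mulr0 //.
  by apply: cvg_trans (@cvg_harmonic R); apply: cvg_app.
Qed.

(** The sets of all lists containing a given finite list generate a proper filter. A limit along [F]
    ignores the lists that miss [i]. *)
Lemma finite_subset_ultra (I : eqType) : exists2 F : set_system (seq I),
  UltraFilter F & forall i : I, F [set r : seq I | i \in r].
Proof.
pose F0 : set_system (seq I) :=
  [set A | exists r0 : seq I, forall r : seq I, {subset r0 <= r} -> A r].
have F0P : ProperFilter F0.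
  apply: Build_ProperFilter_ex; first by move=> A [r0 Ar0]; exists r0; exact: Ar0.
  split.
  - by exists [::].
  - move=> A B [r Ar] [s Bs]; exists (r ++ s) => t rst; split.
      by apply: Ar => i ir; apply: rst; rewrite mem_cat ir.
    by apply: Bs => i ir; apply: rst; rewrite mem_cat ir orbT.
  - by move=> A B AB [r Ar]; exists r => s rs; apply/AB/Ar.
have [F [FU F0F]] := ultraFilterLemma F0P.
by exists F => // i; apply: F0F; exists [:: i] => r; apply; rewrite mem_head.
Qed.

Section Iterates.
Variables (I : eqType) (S : Type) (tau : I -> S -> S).
Variable m0 : (nat -> R) -> R.
Hypothesis m0P : is_mean m0.
Hypothesis m0S : forall f, bounded_real f -> m0 (fun n => f n.+1) = m0 f.
Hypothesis tauC : forall i j s, tau i (tau j s) = tau j (tau i s).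
Implicit Types (f g : S -> R) (r : seq I).

(** Averages along the orbits of the maps [tau i] for [i] in [r], one map after the other, with the
    head of [r] outermost. *)
Definition orbit_mean r f : S -> R :=
  foldr (fun i g s => m0 (fun n => g (iter n (tau i) s))) f r.

Lemma orbit_mean_norm r f c : (forall s, `|f s| <= c) ->
  forall s, `|orbit_mean r f s| <= c.
Proof. by move=> fc; elim: r => //= i r IH s; apply: (mean_norm m0P). Qed.

Lemma orbit_mean_bounded r f (T : Type) (h : T -> S) : bounded_real f ->
  bounded_real (fun t => orbit_mean r f (h t)).
Proof. by move=> [c fc]; exists c => t; exact: orbit_mean_norm. Qed.

Lemma orbit_mean_cst r a s : orbit_mean r (fun=> a) s = a.
Proof.
elim: r s => //= i r IH s.
by under [X in m0 X]eq_fun do rewrite IH; rewrite (mean_cst m0P).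
Qed.

Lemma orbit_mean_ge0 r f : bounded_real f -> (forall s, 0 <= f s) ->
  forall s, 0 <= orbit_mean r f s.
Proof.
move=> fb f0; elim: r => //= i r IH s; apply: (mean_ge0 m0P) => //.
exact: orbit_mean_bounded.
Qed.

Lemma orbit_mean_lin r a f g s : bounded_real f -> bounded_real g ->
  orbit_mean r (fun s => a * f s + g s) s = a * orbit_mean r f s + orbit_mean r g s.
Proof.
move=> fb gb; elim: r s => //= i r IH s.
under [X in m0 X]eq_fun do rewrite IH.
by rewrite (mean_lin m0P) //; exact: orbit_mean_bounded.
Qed.

Lemma orbit_mean_comm r j f s :
  orbit_mean r (fun s => f (tau j s)) s = orbit_mean r f (tau j s).
Proof.
elim: r s => //= i r IH s; congr m0; apply/funext => n; rewrite IH; congr orbit_mean.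
by elim: n => //= n <-; rewrite tauC.
Qed.

(** Induction deals with the indices of the tail. For the head, [tau j] leaves the averages over the
    tail by commutation and becomes a shift of [n] in the outermost average, which [m0] ignores. *)
Lemma orbit_mean_invariant r j f s : bounded_real f -> j \in r ->
  orbit_mean r (fun s => f (tau j s)) s = orbit_mean r f s.
Proof.
move=> fb; elim: r s => //= i r IH s; rewrite inE.
have [/IH {}IH _|_] := boolP (j \in r).
  by congr m0; apply/funext => n; rewrite IH.
rewrite orbF => /eqP ->.
under [X in m0 X]eq_fun do rewrite orbit_mean_comm -iterS.
exact: (m0S (orbit_mean_bounded r (fun n => iter n (tau i) s) fb)).
Qed.

End Iterates.

(** This is the amenability of commutative semigroups. Averaging over the orbits of finitely many
    maps gives invariance under each of them, and the limit over growing lists is invariant under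
    all. *)
Lemma commuting_maps_mean (I : eqType) (S : Type) (s0 : S) (tau : I -> S -> S) :
  (forall i j s, tau i (tau j s) = tau j (tau i s)) ->
  exists2 m : (S -> R) -> R, is_mean m &
    forall i f, bounded_real f -> m (fun s => f (tau i s)) = m f.
Proof.
move=> tauC; have [m0 m0P m0S] := shift_invariant_mean.
have [F FU FI] := finite_subset_ultra I; have [LM _] := ulim_mult R FU.
exists (fun f => ulim F (fun r => orbit_mean tau m0 r f s0)); first split.
- by under eq_fun do rewrite orbit_mean_cst //; rewrite (mean_cst LM).
- move=> f fb f0; apply: (mean_ge0 LM) => [|r]; last exact: orbit_mean_ge0.
  by have [c fc] := fb; exists c => r; exact: orbit_mean_norm.
- move=> a f g fb gb; under eq_fun do rewrite orbit_mean_lin //.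
  rewrite (mean_lin LM) //.
    by have [c fc] := fb; exists c => r; exact: orbit_mean_norm.
  by have [c gc] := gb; exists c => r; exact: orbit_mean_norm.
- move=> i f fb; apply: ulim_near.
    by have [c fc] := fb; exists c => r; exact: orbit_mean_norm.
  by apply: filterS (FI i) => r ir; exact: orbit_mean_invariant.
Qed.

End CommutingMean.

(** * Unitarily invariant norms and means of matrices *)

Section UnitaryNorm.
Variables (R : realType) (k : nat) (N : 'M[R[i]]_k -> R).
Hypothesis NP : is_unitary_norm N.
Local Notation C := R[i].
Local Notation M := 'M[C]_k.
Local Open Scope sesquilinear_scope.
Implicit Types A B u v : M.

Lemma unorm0 : N 0 = 0.
Proof. by rewrite -(scale0r (0 : M)) (unormZ NP) Normc.normc0 mul0r. Qed.

Lemma unormN A : N (- A) = N A.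
Proof.
rewrite -scaleN1r (unormZ NP) -[X in _ = X]mul1r; congr (_ * _).
by rewrite normcN Normc.normc1.
Qed.

Lemma unormBC A B : N (A - B) = N (B - A).
Proof. by rewrite -unormN opprB. Qed.

Lemma ler_unormB A B : N (A - B) <= N A + N B.
Proof. by rewrite -(unormN B) (unormD NP). Qed.

Lemma unorm_triangle B A D : N (A - D) <= N (A - B) + N (B - D).
Proof. by rewrite -(subrKA B) (unormD NP). Qed.

Lemma unorm_leT B A D a b : N (A - B) <= a -> N (B - D) <= b -> N (A - D) <= a + b.
Proof. by move=> AB BD; rewrite (le_trans (unorm_triangle B _ _)) // lerD. Qed.

Lemma unormZr (r : R) A : N (r%:C%C *: A) = `|r| * N A.
Proof. by rewrite (unormZ NP) /= expr0n addr0 sqrtr_sqr. Qed.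

Lemma unorm_sum (I : Type) (r : seq I) (F : I -> M) :
  N (\sum_(i <- r) F i) <= \sum_(i <- r) N (F i).
Proof.
elim: r => [|i r IH]; first by rewrite !big_nil unorm0.
by rewrite !big_cons (le_trans (unormD NP _ _)) // lerD2l.
Qed.

Lemma unitarymx1 : (1%:M : M) \is unitarymx.
Proof. by apply/unitarymxP; rewrite trmx1 map_mx1 mulmx1. Qed.

Lemma unitarymxV u : u \is unitarymx -> u ^t* \is unitarymx.
Proof. by rewrite trmxC_unitary. Qed.

Lemma unitarymxM u v : u \is unitarymx -> v \is unitarymx -> u *m v \is unitarymx.
Proof. exact: mul_unitarymx. Qed.

Lemma unitaryKl u : u \is unitarymx -> u ^t* *m u = 1%:M.
Proof. by move=> uU; rewrite -invmx_unitary // mulVmx // unitarymx_unit. Qed.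

Lemma unitary_conjM u A B : u \is unitarymx ->
  (u ^t* *m A *m u) *m (u ^t* *m B *m u) = u ^t* *m (A *m B) *m u.
Proof.
by move=> uU; rewrite !mulmxA -(mulmxA _ u (u ^t*)) (unitarymxP uU) mulmx1.
Qed.

Lemma unorm_mull u A : u \is unitarymx -> N (u *m A) = N A.
Proof. by move=> uU; rewrite -[u *m A]mulmx1; exact: (unorm_biinv NP A uU unitarymx1). Qed.

Lemma unorm_mulr u A : u \is unitarymx -> N (A *m u) = N A.
Proof. by move=> uU; rewrite -[in LHS](mul1mx A); exact: (unorm_biinv NP A unitarymx1 uU). Qed.

Lemma unorm_unitary u : u \is unitarymx -> N u = N 1%:M.
Proof. by move=> uU; rewrite -[u]mulmx1 unorm_mull. Qed.

(** Use [u^* - v^* = u^* (v - u) v^*]. *)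
Lemma unorm_adjB u v : u \is unitarymx -> v \is unitarymx ->
  N (u ^t* - v ^t*) = N (u - v).
Proof.
move=> uU vU; rewrite -[RHS](unorm_mull _ (unitarymxV uU)).
rewrite -[RHS](unorm_mulr _ (unitarymxV vU)) mulmxBr mulmxBl unitaryKl // mul1mx.
by rewrite -mulmxA (unitarymxP _) // mulmx1 unormBC.
Qed.

Lemma unorm_delta_gt0 i j : 0 < N (delta_mx i j).
Proof.
rewrite lt_def (unorm_ge0 NP) andbT; apply/eqP => /(unorm_eq0 NP)/matrixP/(_ i j).
by rewrite !mxE !eqxx => /eqP; rewrite oner_eq0.
Qed.

(** Multiplying [A] by elementary matrices on both sides isolates the entry. Hence bounded families
    of matrices have bounded entries, and means can be taken entrywise. *)
Lemma unorm_entry i j : exists2 c, 0 <= c & forall A, Normc.normc (A i j) <= c * N A.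
Proof.
exists (N (delta_mx i i) * N (delta_mx j j) / N (delta_mx i j)) => [|A].
  by rewrite divr_ge0 ?mulr_ge0 // (unorm_ge0 NP).
rewrite mulrAC ler_pdivlMr ?unorm_delta_gt0 // -(unormZ NP).
have -> : A i j *: delta_mx i j = delta_mx i i *m A *m delta_mx j j.
  apply/matrixP => x y; rewrite !mxE (bigD1 j) //= big1 => [|l lj]; last first.
    by rewrite !mxE (negPf lj) mulr0.
  rewrite !mxE (bigD1 i) //= big1 => [|l li]; last by rewrite !mxE (negPf li) andbF mul0r.
  rewrite !mxE !eqxx !addr0 /= andbT.
  by case: (x == i); case: (y == j); rewrite ?(mul1r, mulr1, mul0r, mulr0).
rewrite (le_trans (unormM NP _ _)) // mulrAC ler_wpM2r ?(unorm_ge0 NP) //.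
by rewrite (unormM NP).
Qed.

Lemma unorm_le_entries A :
  N A <= \sum_i \sum_j Normc.normc (A i j) * N (delta_mx i j).
Proof.
rewrite {1}(matrix_sum_delta A) (le_trans (unorm_sum _ _)) // ler_sum // => i _.
by rewrite (le_trans (unorm_sum _ _)) // ler_sum // => j _; rewrite (unormZ NP).
Qed.

End UnitaryNorm.

(** * Entrywise means of matrix-valued functions *)

Section MatrixMean.
Variables (R : realType) (k : nat) (N : 'M[R[i]]_k -> R).
Hypothesis NP : is_unitary_norm N.
Local Notation C := R[i].
Local Notation M := 'M[C]_k.
Local Open Scope sesquilinear_scope.

Definition bounded_mx (S : Type) (f : S -> M) := exists c, forall s, N (f s) <= c.

Definition cmean (S : Type) (m : (S -> R) -> R) (f : S -> C) : C :=
  Complex (m (fun s => complex.Re (f s))) (m (fun s => complex.Im (f s))).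

Definition mxmean (S : Type) (m : (S -> R) -> R) (f : S -> M) : M :=
  \matrix_(i, j) cmean m (fun s => f s i j).

Section Theory.
Variables (S : Type) (m : (S -> R) -> R).
Hypothesis mP : is_mean m.

Definition bounded_complex (f : S -> C) :=
  bounded_real (fun s => complex.Re (f s)) /\ bounded_real (fun s => complex.Im (f s)).

Lemma bounded_complex_cst a : bounded_complex (fun=> a).
Proof. by split; exact: bounded_real_cst. Qed.

Lemma bounded_complexD f g : bounded_complex f -> bounded_complex g ->
  bounded_complex (fun s => f s + g s).
Proof.
move=> [f1 f2] [g1 g2]; split; [move: (bounded_realD f1 g1)|move: (bounded_realD f2 g2)];
  by congr bounded_real; apply/funext => s; case: (f s) (g s) => [? ?] [? ?].
Qed.

Lemma bounded_complexM f g : bounded_complex f -> bounded_complex g ->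
  bounded_complex (fun s => f s * g s).
Proof.
move=> [f1 f2] [g1 g2]; split.
  move: (bounded_realB (bounded_realM f1 g1) (bounded_realM f2 g2)).
  by congr bounded_real; apply/funext => s; case: (f s) (g s) => [? ?] [? ?].
move: (bounded_realD (bounded_realM f1 g2) (bounded_realM f2 g1)).
by congr bounded_real; apply/funext => s; case: (f s) (g s) => [? ?] [? ?].
Qed.

Lemma bounded_complex_sum (I : Type) (r : seq I) (F : I -> S -> C) :
  (forall i, bounded_complex (F i)) -> bounded_complex (fun s => \sum_(i <- r) F i s).
Proof.
move=> Fb; elim: r => [|i r IH].
  by under eq_fun do rewrite big_nil; exact: bounded_complex_cst.
by under eq_fun do rewrite big_cons; exact: bounded_complexD.
Qed.

Lemma cmean_cst a : cmean m (fun=> a) = a.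
Proof. by case: a => x y; rewrite /cmean /= !(mean_cst mP). Qed.

Lemma cmeanD f g : bounded_complex f -> bounded_complex g ->
  cmean m (fun s => f s + g s) = cmean m f + cmean m g.
Proof.
move=> [f1 f2] [g1 g2]; rewrite /cmean; congr Complex; rewrite -(meanD mP) //;
  by congr m; apply/funext => s; case: (f s) (g s) => [? ?] [? ?].
Qed.

Lemma cmeanZ a f : bounded_complex f ->
  cmean m (fun s => a * f s) = a * cmean m f.
Proof.
case: a => x y [f1 f2]; rewrite /cmean; congr Complex;
  rewrite -!(meanZ mP) // -?(meanB mP) -?(meanD mP); try exact: bounded_realZ;
  by congr m; apply/funext => s; case: (f s) => [? ?].
Qed.

Lemma cmean_sum (I : Type) (r : seq I) (F : I -> S -> C) :
  (forall i, bounded_complex (F i)) ->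
  cmean m (fun s => \sum_(i <- r) F i s) = \sum_(i <- r) cmean m (F i).
Proof.
move=> Fb; elim: r => [|i r IH].
  by rewrite big_nil; under eq_fun do rewrite big_nil; rewrite cmean_cst.
rewrite big_cons; under eq_fun do rewrite big_cons.
by rewrite cmeanD ?IH//; exact: bounded_complex_sum.
Qed.

Lemma cmean_conj f : bounded_complex f ->
  cmean m (fun s => Num.conj (f s)) = Num.conj (cmean m f).
Proof.
move=> [f1 f2]; rewrite /cmean /=.
have E (z : C) : Num.conj z = Complex (complex.Re z) (- complex.Im z) by case: z.
rewrite E /=; under [X in m X]eq_fun do rewrite E /=.
by under [X in Complex _ (m X)]eq_fun do rewrite E /=; rewrite (meanN mP).
Qed.

Lemma bounded_mx_entry f i j : bounded_mx f -> bounded_complex (fun s => f s i j).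
Proof.
move=> [c fc]; have [b b0 bN] := unorm_entry NP i j.
have le_normc (z : C) : `|complex.Re z| <= Normc.normc z /\ `|complex.Im z| <= Normc.normc z.
  case: z => x y /=; rewrite -(sqrtr_sqr x) -(sqrtr_sqr y).
  by rewrite !ler_sqrt ?addr_ge0 ?sqr_ge0 // lerDl lerDr !sqr_ge0.
have bc s : Normc.normc (f s i j) <= b * c by rewrite (le_trans (bN _)) // ler_wpM2l.
by split; exists (b * c) => s;
  [exact: le_trans (le_normc _).1 (bc s)|exact: le_trans (le_normc _).2 (bc s)].
Qed.

Lemma bounded_mx_cst A : bounded_mx (fun _ : S => A).
Proof. by exists (N A). Qed.

Lemma bounded_mxD (f g : S -> M) : bounded_mx f -> bounded_mx g ->
  bounded_mx (fun s => f s + g s).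
Proof.
move=> [b fb] [c gc]; exists (b + c) => s.
by rewrite (le_trans (unormD NP _ _)) // lerD.
Qed.

Lemma bounded_mxN (f : S -> M) : bounded_mx f -> bounded_mx (fun s => - f s).
Proof. by move=> [b fb]; exists b => s; rewrite (unormN NP). Qed.

Lemma bounded_mxB (f g : S -> M) : bounded_mx f -> bounded_mx g ->
  bounded_mx (fun s => f s - g s).
Proof. by move=> fb gb; apply: bounded_mxD => //; exact: bounded_mxN. Qed.

Lemma bounded_mxM (f g : S -> M) : bounded_mx f -> bounded_mx g ->
  bounded_mx (fun s => f s *m g s).
Proof.
move=> [b fb] [c gc]; exists (b * c) => s.
by rewrite (le_trans (unormM NP _ _)) // ler_pM ?(unorm_ge0 NP).
Qed.

Lemma bounded_unitary (f : S -> M) : (forall s, f s \is unitarymx) -> bounded_mx f.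
Proof. by move=> fU; exists (N 1%:M) => s; rewrite (unorm_unitary NP). Qed.

Lemma mxmean_cst A : mxmean m (fun=> A) = A.
Proof. by apply/matrixP => i j; rewrite mxE cmean_cst. Qed.

Lemma mxmeanD (f g : S -> M) : bounded_mx f -> bounded_mx g ->
  mxmean m (fun s => f s + g s) = mxmean m f + mxmean m g.
Proof.
move=> fb gb; apply/matrixP => i j; rewrite !mxE.
under [X in cmean _ X]eq_fun do rewrite mxE.
by rewrite cmeanD //; exact: bounded_mx_entry.
Qed.

Lemma mxmean_mull A (f : S -> M) : bounded_mx f ->
  mxmean m (fun s => A *m f s) = A *m mxmean m f.
Proof.
move=> fb; apply/matrixP => i j; rewrite !mxE.
under [X in cmean _ X]eq_fun do rewrite mxE.
rewrite cmean_sum => [|l].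
  by apply: eq_bigr => l _; rewrite mxE cmeanZ //; exact: bounded_mx_entry.
by apply: bounded_complexM; [exact: bounded_complex_cst|exact: bounded_mx_entry].
Qed.

Lemma mxmean_mulr A (f : S -> M) : bounded_mx f ->
  mxmean m (fun s => f s *m A) = mxmean m f *m A.
Proof.
move=> fb; apply/matrixP => i j; rewrite !mxE.
under [X in cmean _ X]eq_fun do rewrite mxE.
rewrite cmean_sum => [|l]; last first.
  by apply: bounded_complexM; [exact: bounded_mx_entry|exact: bounded_complex_cst].
apply: eq_bigr => l _; rewrite mxE mulrC -cmeanZ; last exact: bounded_mx_entry.
by congr cmean; apply/funext => s; rewrite mulrC.
Qed.

Lemma mxmeanN (f : S -> M) : bounded_mx f -> mxmean m (fun s => - f s) = - mxmean m f.
Proof.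
move=> fb; rewrite -[RHS]mul1mx mulmxN -mulNmx -mxmean_mull //.
by congr mxmean; apply/funext => s; rewrite mulNmx mul1mx.
Qed.

Lemma mxmeanB (f g : S -> M) : bounded_mx f -> bounded_mx g ->
  mxmean m (fun s => f s - g s) = mxmean m f - mxmean m g.
Proof. by move=> fb gb; rewrite mxmeanD ?mxmeanN //; exact: bounded_mxN. Qed.

Lemma mxmean_adj (f : S -> M) : bounded_mx f ->
  mxmean m (fun s => (f s) ^t*) = (mxmean m f) ^t*.
Proof.
move=> fb; apply/matrixP => i j; rewrite !mxE.
under [X in cmean _ X]eq_fun do rewrite !mxE.
by rewrite cmean_conj //; exact: bounded_mx_entry.
Qed.

(** An entrywise mean does not see [N], so the bound is carried over by convexity: one convex
    combination of points approximates the means of all entries at once, and the same combination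
    [A] of values of [f] has norm at most [c]. *)
Lemma mxmean_norm (f : S -> M) c : (forall s, N (f s) <= c) -> N (mxmean m f) <= c.
Proof.
move=> fc; have fb : bounded_mx f by exists c.
apply/ler_addgt0Pl => e e0.
pose D := \sum_(i < k) \sum_(j < k) N (delta_mx i j).
have D0 : 0 <= D by apply: sumr_ge0 => i _; apply: sumr_ge0 => j _; exact: (unorm_ge0 NP).
(* Each entry errs by [d] in the real and by [d] in the imaginary part, a total of at most
   [(d + d) * D <= e]; the [1] keeps the divisor positive. *)
pose d := e / (D + D + 1).
have d0 : 0 < d by rewrite divr_gt0 // ltr_wpDl // addr_ge0.
pose h (x : 'I_k * 'I_k * bool) s :=
  if x.2 then complex.Re (f s x.1.1 x.1.2) else complex.Im (f s x.1.1 x.1.2).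
have [|T [w [p [w0 w1 wh]]]] := mean_approx mP (h := h) _ d0.
  move=> [[i j] b]; have [] := bounded_mx_entry i j fb.
  by rewrite /h; case: b.
pose A := \sum_t (w t)%:C%C *: f (p t).
have NA : N A <= c.
  rewrite (le_trans (unorm_sum NP _ _)) // -[X in _ <= X]mul1r -w1 mulr_suml ler_sum // => t _.
  by rewrite (unormZr NP) ger0_norm // ler_wpM2l.
have NB : N (mxmean m f - A) <= e.
  have -> : e = d * (D + D + 1) by rewrite /d divfK // gt_eqF // ltr_wpDl // addr_ge0.
  rewrite (le_trans (unorm_le_entries NP _)) //.
  apply: (@le_trans _ _ ((d + d) * D)); last by nra.
  rewrite mulr_sumr ler_sum // => i _; rewrite mulr_sumr ler_sum // => j _.
  rewrite ler_wpM2r ?(unorm_ge0 NP) //.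
  have hre := wh (i, j, true); have him := wh (i, j, false).
  have -> : (mxmean m f - A) i j =
      Complex (m (h (i, j, true)) - \sum_t w t * h (i, j, true) (p t)) 0 +
      Complex 0 (m (h (i, j, false)) - \sum_t w t * h (i, j, false) (p t)).
    have ReD : {morph @complex.Re R : x y / x + y} by case=> ? ? [? ?].
    have ImD : {morph @complex.Im R : x y / x + y} by case=> ? ? [? ?].
    have ReN (x : C) : complex.Re (- x) = - complex.Re x by case: x.
    have ImN (x : C) : complex.Im (- x) = - complex.Im x by case: x.
    have ReZ (r : R) (x : C) : complex.Re (r%:C%C * x) = r * complex.Re x.
      by case: x => ? ? /=; rewrite mul0r subr0.
    have ImZ (r : R) (x : C) : complex.Im (r%:C%C * x) = r * complex.Im x.
      by case: x => ? ? /=; rewrite mul0r addr0.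
    rewrite !mxE summxE; apply/eqP; rewrite eq_complex; apply/andP; split; apply/eqP.
      rewrite ReD ReN (big_morph _ ReD (erefl _)) /= addr0; congr (_ - _).
      by apply: eq_bigr => t _; rewrite mxE ReZ.
    rewrite ImD ImN (big_morph _ ImD (erefl _)) /= add0r; congr (_ - _).
    by apply: eq_bigr => t _; rewrite mxE ImZ.
  rewrite (le_trans (le_normcD _ _)) // lerD //=.
    by rewrite expr0n addr0 sqrtr_sqr.
  by rewrite expr0n add0r sqrtr_sqr.
rewrite -[mxmean m f](subrK A) (le_trans (unormD NP _ _)) // lerD //.
Qed.

End Theory.

Lemma mxmean_mult (S : Type) (m : (S -> R) -> R) (f g : S -> M) : is_mult_mean m ->
  bounded_mx f -> bounded_mx g ->
  mxmean m (fun s => f s *m g s) = mxmean m f *m mxmean m g.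
Proof.
move=> [mP mM] fb gb; apply/matrixP => i j; rewrite !mxE.
under [X in cmean _ X]eq_fun do rewrite mxE.
rewrite (cmean_sum mP) => [|l]; last by apply: bounded_complexM; exact: bounded_mx_entry.
apply: eq_bigr => l _; rewrite !mxE.
have [f1 f2] := bounded_mx_entry i l fb; have [g1 g2] := bounded_mx_entry l j gb.
rewrite /cmean; congr Complex; rewrite -!mM //.
  by rewrite -(meanB mP); try exact: bounded_realM; congr m; apply/funext => s;
    case: (f s i l) (g s l j) => [? ?] [? ?].
by rewrite -(meanD mP); try exact: bounded_realM; congr m; apply/funext => s;
  case: (f s i l) (g s l j) => [? ?] [? ?].
Qed.

Lemma mxmean_unitary (S : Type) (m : (S -> R) -> R) (f : S -> M) : is_mult_mean m ->
  (forall s, f s \is unitarymx) -> mxmean m f \is unitarymx.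
Proof.
move=> mM fU; have fb := bounded_unitary fU.
apply/unitarymxP; rewrite -(mxmean_adj mM.1 fb) -mxmean_mult //.
  under eq_fun do rewrite (unitarymxP (fU _)).
  by rewrite (mxmean_cst mM.1).
by apply: bounded_unitary => s; exact: unitarymxV.
Qed.

End MatrixMean.

(** * Polar decomposition *)

Section Polar.
Variables (R : realType) (k : nat) (N : 'M[R[i]]_k -> R).
Hypothesis NP : is_unitary_norm N.
Local Notation C := R[i].
Local Notation M := 'M[C]_k.
Local Open Scope sesquilinear_scope.

Definition diagf (f : 'I_k -> C) : M := diag_mx (\row_i f i).

Lemma diagfM f g : diagf f *m diagf g = diagf (fun i => f i * g i).
Proof. by rewrite /diagf mulmx_diag; congr diag_mx; apply/rowP => i; rewrite !mxE. Qed.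

Lemma diagf_adj f : (diagf f) ^t* = diagf (fun i => Num.conj (f i)).
Proof.
apply/matrixP => i j; rewrite !mxE eq_sym; case: eqP => [->|_]; rewrite ?mulr1n //.
by rewrite !mulr0n rmorph0.
Qed.

Lemma diagf1 : diagf (fun=> 1) = 1%:M.
Proof. by apply/matrixP => i j; rewrite !mxE. Qed.

Lemma adjM (A B : M) : (A *m B) ^t* = B ^t* *m A ^t*.
Proof. by rewrite trmx_mul map_mxM. Qed.

(* A diagonal matrix with entries [cos t] in [[0, 1]] is the average of the
   unitary diagonal matrices with entries [exp(i t)] and [exp(-i t)]. *)
Lemma unorm_diag_contraction (A : M) (e : 'I_k -> R) : (forall i, 0 <= e i <= 1) ->
  N (A *m diagf (fun i => (e i)%:C%C)) <= N A.
Proof.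
move=> e01; pose u (b : bool) i : C := Complex (e i) ((-1) ^+ b * Num.sqrt (1 - e i ^+ 2)).
have uU b : diagf (u b) \is unitarymx.
  apply/unitarymxP; rewrite diagf_adj diagfM -diagf1; congr diagf; apply/funext => i.
  have /andP[e0 e1] := e01 i.
  have e2 : 0 <= 1 - e i ^+ 2 by rewrite subr_ge0 expr_le1.
  have sq := sqr_sqrtr e2.
  apply/eqP; rewrite eq_complex /u /=; case: b; rewrite ?expr1 ?expr0 /=;
  by apply/andP; split; apply/eqP; ring: sq.
have -> : diagf (fun i => (e i)%:C%C) =
    (2^-1 : R)%:C%C *: diagf (u true) + (2^-1 : R)%:C%C *: diagf (u false).
  apply/matrixP => i j; rewrite !mxE; case: (i == j); rewrite ?mulr0n ?mulr0 ?addr0 // !mulr1n.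
  apply/eqP; rewrite eq_complex /u /= expr1 expr0.
  by apply/andP; split; apply/eqP; field.
rewrite mulmxDr (le_trans (unormD NP _ _)) // -!scalemxAr !(unormZr NP).
rewrite !(unorm_mulr NP) //; rewrite ger0_norm ?invr_ge0 //; lra.
Qed.

Lemma hermitian_unitary_diag (A : M) : A ^t* = A ->
  exists2 P : M, P \is unitarymx & exists d, P *m A = diagf d *m P.
Proof.
move=> AH; exists (spectralmx A); first exact: spectral_unitarymx.
exists (fun i => spectral_diag A 0 i).
have /orthomx_spectralP AE : A \is normalmx by apply/normalmxP; rewrite AH.
have -> : diagf (fun i => spectral_diag A 0 i) = diag_mx (spectral_diag A).
  by congr diag_mx; apply/rowP => i; rewrite mxE.
by rewrite {2}AE -mulmxA (mulKVmx (spectral_unit A)).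
Qed.

(* [W] is the unitary part [X (X^* X)^(-1/2)] of the polar decomposition of [X]. *)
Lemma near_unitary (X : M) : N (X ^t* *m X - 1%:M) < 1 ->
  exists2 W, W \is unitarymx & N (W - X) <= N (X ^t* *m X - 1%:M).
Proof.
set A := X ^t* *m X => NA1.
have AH : A ^t* = A by rewrite /A adjM trmxCK.
have [P PU [d PA]] := hermitian_unitary_diag AH.
have PV := unitarymxP PU; have VP := unitaryKl PU.
have dE : diagf d = (X *m P ^t*) ^t* *m (X *m P ^t*).
  by rewrite adjM trmxCK -mulmxA (mulmxA (X ^t*)) -/A mulmxA PA -mulmxA PV mulmx1.
have d0 i : 0 <= d i.
  have := congr1 (fun B : M => B i i) dE; rewrite !mxE eqxx mulr1n => ->.
  by apply: sumr_ge0 => l _; rewrite !mxE mulrC mul_conjC_ge0.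
have [r rd r0] : exists2 r : 'I_k -> R, d = (fun i => (r i)%:C%C) & forall i, 0 <= r i.
  exists (fun i => complex.Re (d i)) => [|i].
    by apply/funext => i; rewrite RRe_real // ger0_real.
  by have := d0 i; rewrite lecE => /andP[].
(* If [r i = 0], right multiplication by [A - 1%:M] maps [delta_mx i i *m P] to its negative, which
   contradicts [N (A - 1%:M) < 1]. *)
have rpos i : 0 < r i.
  rewrite lt_def r0 andbT; apply/eqP => ri0.
  have : N (delta_mx i i *m P *m (A - 1%:M)) = N (delta_mx i i).
    rewrite mulmxBr mulmx1 -mulmxA PA mulmxA.
    have -> : delta_mx i i *m diagf d = 0.
      apply/matrixP => a b; rewrite !mxE big1 // => l _; rewrite !mxE rd.
      have [->|li] := eqVneq l i; last by rewrite andbF mul0r.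
      by rewrite ri0 rmorph0 mul0rn mulr0.
    by rewrite mul0mx sub0r (unormN NP) (unorm_mulr NP).
  have := unormM NP (delta_mx i i *m P) (A - 1%:M).
  rewrite (unorm_mulr NP _ PU) => le1 E; have := unorm_delta_gt0 NP i i => gt0.
  by move: le1; rewrite E; nra.
pose s i := Num.sqrt (r i).
have s0 i : 0 < s i by rewrite sqrtr_gt0.
have ss i : s i * s i = r i by rewrite -expr2 sqr_sqrtr.
pose Sm := diagf (fun i => (s i)%:C%C); pose Sv := diagf (fun i => ((s i)^-1)%:C%C).
have conjR (x : R) : Num.conj (x%:C%C : C) = x%:C%C.
  by apply/eqP; rewrite eq_complex /= oppr0 !eqxx.
have SvS : Sv *m Sm = 1%:M.
  rewrite diagfM -diagf1; congr diagf; apply/funext => i.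
  by rewrite -rmorphM /= mulVf ?gt_eqF.
have WW : (X *m P ^t* *m Sv) ^t* *m (X *m P ^t* *m Sv) = 1%:M.
  rewrite adjM mulmxA -(mulmxA _ _ (X *m P ^t*)) -dE.
  rewrite /Sv diagf_adj !diagfM -diagf1; congr diagf; apply/funext => i.
  rewrite conjR rd -!rmorphM /= -ss mulrA mulVf ?mul1r ?mulfV ?gt_eqF //.
pose W := X *m P ^t* *m Sv.
have WU : W \is unitarymx by apply/unitarymxP/mulmx1C.
exists (W *m P); first exact: unitarymxM.
have XE : X = W *m Sm *m P by rewrite -[W *m Sm]mulmxA SvS mulmx1 -mulmxA VP mulmx1.
rewrite [in X in X <= _]XE -mulmxBl (unorm_mulr NP) // -[in X in X <= _](mulmx1 W).
rewrite -mulmxA mul1mx -mulmxBr (unorm_mull NP) //.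
have -> : N (A - 1%:M) = N (1%:M - diagf d).
  rewrite -(unorm_mull NP _ PU) mulmxBr PA mulmx1 -[X in _ - X]mul1mx -mulmxBl.
  by rewrite (unorm_mulr NP) // (unormBC NP).
(* On the diagonal, [1 - s = (1 - s^2) / (1 + s)], and the factor [1 / (1 + s)] lies in [[0, 1]]. *)
have -> : 1%:M - Sm = (1%:M - diagf d) *m diagf (fun i => ((1 + s i)^-1)%:C%C).
  rewrite mulmxBl mul1mx diagfM -diagf1 /Sm; apply/matrixP => i j; rewrite !mxE.
  case: (i == j); last by rewrite !mulr0n subr0.
  rewrite !mulr1n rd -!rmorphM -(rmorph1 (real_complex R)) -!rmorphB /= -ss; congr (_%:C%C).
  by have := s0 i; move=> si; field; rewrite gt_eqF // addr_gt0.
apply: unorm_diag_contraction => i; have si := s0 i.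
have s1 : 0 < 1 + s i by rewrite addr_gt0.
by rewrite invr_ge0 (ltW s1) invf_le1 // lerDl ltW.
Qed.

End Polar.

(** * Approximate homomorphisms of amenable semigroups *)

Section Kazhdan.
Variables (R : realType) (k : nat) (N : 'M[R[i]]_k -> R).
Hypothesis NP : is_unitary_norm N.
Local Notation C := R[i].
Local Notation M := 'M[C]_k.
Local Open Scope sesquilinear_scope.

Lemma mxmean_ulim_near (T : Type) (F : set_system T) (f g : T -> M) : UltraFilter F ->
  bounded_mx N g -> (\forall t \near F, f t = g t) ->
  mxmean (ulim F) f = mxmean (ulim F) g.
Proof.
move=> FU gb fg; apply/matrixP => i j; rewrite !mxE /cmean.
have [g1 g2] := bounded_mx_entry NP i j gb.
by congr Complex; apply: ulim_near => //; apply: filterS fg => t ->.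
Qed.

(** Where the bound fails, [f] may be replaced by [0] without changing the limit. *)
Lemma mxmean_ulim_norm (T : Type) (F : set_system T) (f : T -> M) c : UltraFilter F ->
  (\forall t \near F, N (f t) <= c) -> N (mxmean (ulim F) f) <= c.
Proof.
move=> FU fc.
have c0 : 0 <= c by have /filter_ex [t] := fc; apply: le_trans; exact: (unorm_ge0 NP).
pose g t := if N (f t) <= c then f t else 0.
have gc t : N (g t) <= c by rewrite /g; case: ifP => // _; rewrite (unorm0 NP).
rewrite (@mxmean_ulim_near _ _ _ g).
- exact: (mxmean_norm NP (ulim_mult R FU).1).
- by exists c.
- by apply: filterS fc => t ft; rewrite /g ft.
Qed.

(** The domain carries a bare binary operation: besides groups, it will be the lists under sorted
    concatenation and the wreath product with the law of a quotient. *)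
Definition approx_hom (S : Type) (op : S -> S -> S) (d : R) (phi : S -> M) :=
  forall g h, N (phi (op g h) - phi g *m phi h) <= d.

(** The difference is the mean of the product of the two deviations from the means, so their sizes
    multiply. This is the source of quadratic gains. *)
Lemma mxmean_covariance (S : Type) (m : (S -> R) -> R) (f g : S -> M) a b :
  is_mean m -> bounded_mx N f -> bounded_mx N g ->
  (forall s, N (f s - mxmean m f) <= a) -> (forall s, N (g s - mxmean m g) <= b) ->
  N (mxmean m (fun s => f s *m g s) - mxmean m f *m mxmean m g) <= a * b.
Proof.
move=> mP fb gb fa gb'; set A := mxmean m f; set B := mxmean m g.
have -> : mxmean m (fun s => f s *m g s) - A *m B =
          mxmean m (fun s => (f s - A) *m (g s - B)).
  have cA := bounded_mx_cst N S A; have cB := bounded_mx_cst N S B.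
  transitivity (mxmean m (fun s => (f s *m g s - f s *m B) - (A *m g s - A *m B))).
    rewrite (mxmeanB NP mP); last 2 first.
    - by apply: (bounded_mxB NP); apply: (bounded_mxM NP).
    - by apply: (bounded_mxB NP); apply: (bounded_mxM NP).
    rewrite !(mxmeanB NP mP); try exact: (bounded_mxM NP).
    rewrite (mxmean_mulr NP mP) // (mxmean_mull NP mP) // (mxmean_cst mP).
    by rewrite subrr subr0.
  by congr mxmean; apply/funext => s; rewrite mulmxBl !mulmxBr.
apply: (mxmean_norm NP mP) => s.
by rewrite (le_trans (unormM NP _ _)) // ler_pM ?(unorm_ge0 NP).
Qed.

Section Semigroup.
Variables (S : Type) (op : S -> S -> S) (m : (S -> R) -> R).
Hypothesis opA : associative op.
Hypothesis mP : is_mean m.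
Hypothesis m_inv : forall g f, bounded_real f -> m (fun x => f (op x g)) = m f.

Lemma mxmean_inv g (f : S -> M) : bounded_mx N f ->
  mxmean m (fun x => f (op x g)) = mxmean m f.
Proof.
move=> fb; apply/matrixP => i j; rewrite !mxE /cmean.
have [f1 f2] := bounded_mx_entry NP i j fb.
by congr Complex; exact: m_inv.
Qed.

(* The average [psi g] of [phi x^* phi (x g)] is a homomorphism up to the
   covariance of two functions at distance [O(d)] from their means. *)
Lemma halve_defect (d : R) (phi : S -> M) : 0 <= d -> d <= 40^-1 ->
  (forall g, phi g \is unitarymx) -> approx_hom op d phi ->
  exists psi : S -> M, [/\ forall g, psi g \is unitarymx, approx_hom op (d / 2) psi &
    forall g, N (psi g - phi g) <= d * 2].
Proof.
move=> d0 d1 phiU phid.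
pose F g x := (phi x) ^t* *m phi (op x g); pose q := (d + d) * (d + d).
have q0 : 0 <= q by rewrite mulr_ge0 ?addr_ge0.
(* Here [40^-1] is used: [q = 4 d^2] is at most [d / 10], so the five errors [q] collected in the
   new defect fit into [d / 2]. *)
have q1 : q * 10 <= d.
  have : d * d <= d * 40^-1 by rewrite ler_wpM2l.
  by rewrite /q; lra.
have q2 : q + (q + (q + q + q)) <= d / 2 by lra.
have q3 : q + d <= d * 2 by lra.
have q4 : q < 1 by apply: le_lt_trans (_ : d < 1); lra.
have FU g x : F g x \is unitarymx by apply: unitarymxM => //; exact: unitarymxV.
have Fb g : bounded_mx N (F g) by exact: bounded_unitary (FU g).
pose a g := mxmean m (F g).
have Fphi g x : N (F g x - phi g) <= d.
  rewrite -(unorm_mull NP _ (phiU x)) mulmxBr mulmxA (unitarymxP (phiU x)) mul1mx.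
  exact: phid.
have aphi g : N (a g - phi g) <= d.
  rewrite -[phi g](mxmean_cst (S := S) mP) -(mxmeanB NP mP) //.
    exact: (mxmean_norm NP mP).
  exact: bounded_mx_cst.
have Fa g x : N (F g x - a g) <= d + d.
  by apply: (unorm_leT NP (B := phi g)) => //; rewrite (unormBC NP).
have aM g h : N (a (op g h) - a g *m a h) <= q.
  (* The middle factors cancel because [phi (op x g)] is unitary. By invariance of the mean, the
     second factor still has mean [a h]. *)
  have -> : a (op g h) = mxmean m (fun x => F g x *m F h (op x g)).
    congr mxmean; apply/funext => x; rewrite /F -mulmxA; congr (_ *m _).
    by rewrite mulmxA (unitarymxP (phiU _)) mul1mx opA.
  have Eh : mxmean m (fun x => F h (op x g)) = a h by exact: (mxmean_inv g (Fb h)).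
  have Fhb : bounded_mx N (fun x => F h (op x g)) := bounded_unitary NP (fun x => FU h (op x g)).
  rewrite -Eh; apply: (mxmean_covariance mP (Fb g) Fhb (Fa g)).
  by move=> x; rewrite Eh; exact: Fa.
have aV g : N ((a g) ^t* *m a g - 1%:M) <= q.
  (* [a g] is nearly unitary by the same covariance estimate, applied to [F g] and its adjoint. *)
  have -> : 1%:M = mxmean m (fun x => (F g x) ^t* *m F g x).
    by under eq_fun do rewrite unitaryKl //; rewrite (mxmean_cst mP).
  have FVb : bounded_mx N (fun x => (F g x) ^t*).
    exact: (bounded_unitary NP (fun x => unitarymxV (FU g x))).
  rewrite -(mxmean_adj NP mP (Fb g)) (unormBC NP).
  apply: (mxmean_covariance mP FVb (Fb g) _ (Fa g)) => x.
  have -> : (F g x) ^t* - mxmean m (fun y => (F g y) ^t*) =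
            mxmean m (fun y => (F g x) ^t* - (F g y) ^t*).
    apply: esym; apply: etrans (mxmeanB NP mP (bounded_mx_cst N S ((F g x) ^t*)) FVb) _.
    by congr (_ - _); exact: (mxmean_cst mP).
  apply: (mxmean_norm NP mP) => y; rewrite (unorm_adjB NP) //.
  by apply: (unorm_leT NP (B := phi g)) => //; rewrite (unormBC NP).
have aV1 g : N ((a g) ^t* *m a g - 1%:M) < 1 := le_lt_trans (aV g) q4.
have /choice [psi psiP] : forall g, exists W,
    W \is unitarymx /\ N (W - a g) <= q.
  move=> g; have [W WU Wa] := near_unitary NP (aV1 g).
  by exists W; split => //; exact: le_trans Wa (aV g).
exists psi; split=> [g|g h|g]; first exact: (psiP g).1.
- have h1 := (psiP (op g h)).2; have h2 := aM g h.
  have h3 : N (a g *m a h - a g *m psi h) <= q + q.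
    (* [a g] need not be unitary, so it is split into the unitary [phi g] and a remainder of norm at
       most [1]; each part costs [q]. *)
    rewrite -mulmxBr -[a g](subrK (phi g)) mulmxDl (le_trans (unormD NP _ _)) //.
    rewrite (unorm_mull NP _ (phiU g)) lerD //.
      rewrite (le_trans (unormM NP _ _)) // -[X in _ <= X]mul1r ler_pM ?(unorm_ge0 NP) //.
        by rewrite (le_trans (aphi g)) //; lra.
      by rewrite (unormBC NP) (psiP h).2.
    by rewrite (unormBC NP) (psiP h).2.
  have h4 : N (a g *m psi h - psi g *m psi h) <= q.
    by rewrite -mulmxBl (unorm_mulr NP) ?(psiP h).1 // (unormBC NP) (psiP g).2.
  apply: le_trans (unorm_leT NP h1 (unorm_leT NP h2 (unorm_leT NP h3 h4))) q2.
- apply: le_trans (unorm_leT NP (psiP g).2 (aphi g)) q3.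
Qed.

(** Iterated halving gives defects [d / 2^n], and the displacements [2 d / 2^n] add up to [4 d]. An
    ultrafilter limit of the iterates spares a proof that they converge. *)
Theorem amenable_approx_hom (d : R) (phi : S -> M) : 0 <= d -> d <= 40^-1 ->
  (forall g, phi g \is unitarymx) -> approx_hom op d phi ->
  exists psi : S -> M, [/\ forall g, psi g \is unitarymx,
    forall g h, psi (op g h) = psi g *m psi h & forall g, N (psi g - phi g) <= d * 4].
Proof.
move=> d0 d1 phiU phid.
(* [step] is made total so that the iterates can be defined before their bounds are known; outside
   the hypotheses its value is arbitrary. *)
have /choice [step stepP] : forall x : (S -> M) * R, exists psi : S -> M,
    0 <= x.2 -> x.2 <= 40^-1 -> (forall g, x.1 g \is unitarymx) -> approx_hom op x.2 x.1 ->
    [/\ forall g, psi g \is unitarymx, approx_hom op (x.2 / 2) psi &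
    forall g, N (psi g - x.1 g) <= x.2 * 2].
  move=> [f e] /=; have [H|H] := pselect [/\ 0 <= e, e <= 40^-1,
      forall g, f g \is unitarymx & approx_hom op e f].
    by case: H => h1 h2 h3 h4; have [psi psiP] := halve_defect h1 h2 h3 h4; exists psi.
  by exists f => h1 h2 h3 h4; case: H.
pose e n : R := d * 2^-1 ^+ n.
pose fix it n := if n is n'.+1 then step (it n', e n') else phi.
have half0 : 0 < (2^-1 : R) by rewrite invr_gt0.
have half1 : (2^-1 : R) <= 1 by rewrite invf_le1 ?ler1n.
have pow n : 0 < (2^-1 : R) ^+ n <= 1.
  by apply/andP; split; [exact: exprn_gt0|exact: exprn_ile1 (ltW _) _].
have e0 n : 0 <= e n by have /andP[h1 h2] := pow n; rewrite mulr_ge0 // ltW.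
have e1 n : e n <= 40^-1.
  by have /andP[h1 h2] := pow n; apply: le_trans d1; rewrite ler_piMr.
(* The last bound telescopes: [e n * 2 = (e n - e n.+1) * 4]. *)
have itP n : [/\ forall g, it n g \is unitarymx, approx_hom op (e n) (it n) &
    forall g, N (it n g - phi g) <= (d - e n) * 4].
  elim: n => [|n [IH1 IH2 IH3]].
    by split=> // [|g]; rewrite /e expr0 mulr1 // !subrr mul0r (unorm0 NP).
  have [s1 s2 s3] := stepP (it n, e n) (e0 n) (e1 n) IH1 IH2.
  have eS : e n.+1 = e n / 2 by rewrite /e exprSr mulrA.
  split=> //= [|g]; first by rewrite eS.
  rewrite (le_trans (unorm_triangle NP (it n g) _ _)) //.
  by have := IH3 g; have := s3 g; rewrite /= eS; lra.
have [F FU Foo] := exists_ultra_eventually.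
have LM := ulim_mult R FU; have LP := LM.1.
have itU n := (let: And3 h _ _ := itP n in h).
have itb g : bounded_mx N (fun n => it n g) by apply: bounded_unitary.
exists (fun g => mxmean (ulim F) (fun n => it n g)); split.
- by move=> g; apply: (mxmean_unitary NP LM).
- move=> g h; rewrite -(mxmean_mult NP) //; apply/eqP; rewrite -subr_eq0; apply/eqP.
  rewrite -(mxmeanB NP LP) //; last exact: (bounded_mxM NP).
  apply: (unorm_eq0 NP); apply/eqP; rewrite eq_le (unorm_ge0 NP) andbT.
  apply/ler_addgt0Pl => c c0; rewrite addr0.
  apply: mxmean_ulim_norm; apply: Foo.
  have : (fun n => e n) @ \oo --> (0 : R).
    rewrite -(mulr0 d); apply: cvgM; first exact: cvg_cst.
    by apply: cvg_expr; rewrite ger0_norm ?invr_ge0 // invf_lt1 ?ltr1n.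
  move=> /cvgr_le /(_ c c0); apply: filterS => n.
  by apply: le_trans; case: (itP n).
- move=> g; rewrite -[phi g](mxmean_cst (S := nat) LP) -(mxmeanB NP LP) //.
    apply: (mxmean_norm NP LP) => n; have [_ _ h] := itP n.
    by rewrite (le_trans (h g)) // ler_wpM2r // gerBl.
  exact: bounded_mx_cst.
Qed.

End Semigroup.

End Kazhdan.

(** * Commuting conjugates *)

Section Rigidity.
Variables (R : realType) (k : nat) (N : 'M[R[i]]_k -> R).
Hypothesis NP : is_unitary_norm N.
Local Notation M := 'M[R[i]]_k.

Lemma unitarymxX (X : M) n : X \is unitarymx -> X ^+ n \is unitarymx.
Proof.
move=> XU; elim: n => [|n IH]; first exact: unitarymx1.
by rewrite exprS; exact: unitarymxM.
Qed.

(* The sum of the [X ^+ (n.-1 - i) * Y ^+ i] is within [n * d] of [n * Y ^+ n.-1],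
   and its product with [X - Y] is [X ^+ n - Y ^+ n], which stays bounded. *)
Lemma unitary_powers_close (d : R) (X Y : M) : d < 1 ->
  X \is unitarymx -> Y \is unitarymx -> X *m Y = Y *m X ->
  (forall n, N (X ^+ n - Y ^+ n) <= d) -> X = Y.
Proof.
move=> d1 XU YU XY XYd; apply/eqP; rewrite -subr_eq0; apply/eqP/(unorm_eq0 NP)/eqP.
rewrite eq_le (unorm_ge0 NP) andbT leNgt; apply/negP => NXY.
have d0 : 0 <= d := le_trans (unorm_ge0 NP _) (XYd 0%N).
have bound n : n.+1%:R * (N (X - Y) * (1 - d)) <= d.
  pose E := \sum_(i < n.+1) ((X ^+ (n - i) - Y ^+ (n - i)) * Y ^+ i).
  have NE : N E <= n.+1%:R * d.
    rewrite (le_trans (unorm_sum NP _ _)) // -[X in _ <= X%:R * _]card_ord mulr_natl -sumr_const.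
    by apply: ler_sum => i _; rewrite (unorm_mulr NP) ?unitarymxX.
  have XYE : X ^+ n.+1 - Y ^+ n.+1 = (X - Y) * (Y ^+ n *+ n.+1 + E).
    rewrite subrXX_comm //=; congr (_ * _).
    rewrite -[X in Y ^+ n *+ X]card_ord -sumr_const -big_split /=.
    apply: eq_bigr => i _; have Yn : Y ^+ n = Y ^+ (n - i) * Y ^+ i.
      by rewrite -exprD subnK // -ltnS.
    by rewrite Yn mulrBl [RHS]addrC; exact: esym (subrK _ _).
  have -> : n.+1%:R * (N (X - Y) * (1 - d)) = n.+1%:R * N (X - Y) - N (X - Y) * (n.+1%:R * d).
    by ring.
  rewrite lerBlDr.
  have -> : n.+1%:R * N (X - Y) = N ((X - Y) * (Y ^+ n *+ n.+1)).
    have -> : (X - Y) * (Y ^+ n *+ n.+1) = (n.+1%:R : R[i]) *: ((X - Y) * Y ^+ n).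
      by rewrite scaler_nat mulrnAr.
    rewrite (unormZ NP) (unorm_mulr NP) ?unitarymxX //; congr (_ * _).
    by rewrite -(rmorph_nat (real_complex R)) /= expr0n addr0 sqrtr_sqr ger0_norm.
  have -> : (X - Y) * (Y ^+ n *+ n.+1) = (X ^+ n.+1 - Y ^+ n.+1) - (X - Y) * E.
    by rewrite XYE mulrDr addrK.
  rewrite (le_trans (ler_unormB NP _ _)) // lerD //.
  by rewrite (le_trans (unormM NP _ _)) // ler_wpM2l // (unorm_ge0 NP).
have c0 : 0 < N (X - Y) * (1 - d) by rewrite mulr_gt0 // subr_gt0.
have := bound (Num.bound (d / (N (X - Y) * (1 - d)))).
rewrite -ler_pdivlMr // leNgt => /negP; apply.
have dc0 : 0 <= d / (N (X - Y) * (1 - d)) by rewrite divr_ge0 // ltW.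
by rewrite (lt_trans (archi_boundP dc0)) // ltr_nat.
Qed.

End Rigidity.

(** * Orderings and interleavings of lists *)

Section TotalOrder.

(** Sorting along such an order makes lists canonical representatives of multisets. The order axioms
    follow from the least elements of sets of at most three elements. *)
Lemma exists_total_order (T : eqType) : exists leT : rel T,
  [/\ total leT, transitive leT & antisymmetric leT].
Proof.
have [leT wo] := @well_ordering_principle T.
have min3 x y z : exists2 w, w \in [:: x; y; z] & forall v, v \in [:: x; y; z] -> leT w v.
  have [|w [[wi wl] _]] := wo [in [:: x; y; z]]; first by exists x; rewrite inE eqxx.
  by exists w.
have leT_total : total leT.
  move=> x y; have [w] := min3 x y y.
  rewrite !inE => /or3P[] /eqP -> h; apply/orP; [left|right|right];
    by apply: h; rewrite !inE eqxx ?orbT.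
have leT_anti : antisymmetric leT.
  move=> x y /andP[xy yx]; have [|w [_ wu]] := wo [in [:: x; y]].
    by exists x; rewrite inE eqxx.
  have leTT z : leT z z by have := leT_total z z; rewrite orbb.
  rewrite -(wu x) ?(wu y) //; (split; first by rewrite !inE eqxx ?orbT);
    by move=> z; rewrite !inE => /orP[] /eqP ->.
exists leT; split=> // y x z xy yz.
have [w] := min3 x y z; rewrite !inE => /or3P[] /eqP -> h.
- by apply: h; rewrite !inE eqxx !orbT.
- have yx : leT y x by apply: h; rewrite !inE eqxx.
  by rewrite (leT_anti x y) // xy yx.
- have zy : leT z y by apply: h; rewrite !inE eqxx orbT.
  by rewrite -(leT_anti y z) // yz zy.
Qed.

End TotalOrder.

(** Each entry of the third list is a slot, filled by a letter of the first list, a letter of the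
    second, or the product of one from each. A merge uses only the first two ways, [weave_nseq] only
    the third. *)
Inductive weave (L : Type) (mul : L -> L -> L) : seq L -> seq L -> seq L -> Prop :=
| weave_nil : weave mul [::] [::] [::]
| weave_left a s1 s2 w : weave mul s1 s2 w -> weave mul (a :: s1) s2 (a :: w)
| weave_right a s1 s2 w : weave mul s1 s2 w -> weave mul s1 (a :: s2) (a :: w)
| weave_both a b s1 s2 w : weave mul s1 s2 w ->
    weave mul (a :: s1) (b :: s2) (mul a b :: w).

Lemma weave_merge (L : eqType) (mul : L -> L -> L) (leT : rel L) s1 s2 :
  weave mul s1 s2 (merge leT s1 s2).
Proof.
elim: s1 s2 => [|x s1 IH1] s2.
  by elim: s2 => [|y s2 IH]; [exact: weave_nil|exact: weave_right].
elim: s2 => [|y s2 IH2] /=.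
  have := IH1 [::]; have -> : merge leT s1 [::] = s1 by case: (s1).
  exact: weave_left.
by case: ifP => _; [exact: weave_left (IH1 _)|exact: weave_right].
Qed.

Lemma weave_nseq (L : Type) (mul : L -> L -> L) a b n :
  weave mul (nseq n a) (nseq n b) (nseq n (mul a b)).
Proof. by elim: n => [|n IH]; [exact: weave_nil|exact: weave_both]. Qed.

(** * Iterated ultrafilter limits of translates *)

Section Spread.
Variables (R : realType) (k : nat) (N : 'M[R[i]]_k -> R).
Hypothesis NP : is_unitary_norm N.
Local Notation M := 'M[R[i]]_k.
Variables (T : Type) (p : set_system T).
Hypothesis pU : UltraFilter p.
Variables (L : eqType) (mul : L -> L -> L) (one : L) (act : T -> L -> L).
Hypothesis mulA : associative mul.
Hypothesis mul1 : left_id one mul.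
Hypothesis actM : forall t, {morph act t : a b / mul a b}.
Hypothesis act_comm : forall a b,
  \forall t \near p, mul (act t a) b = mul b (act t a).
Variables (phi : L -> M) (d : R).
Hypothesis phiU : forall a, phi a \is unitarymx.
Hypothesis phid : approx_hom N mul d phi.

(* [spread [:: a1; ...; an] u] is the iterated limit of
   [phi (u * act t1 a1 * ... * act tn an)], with [t1] in the outermost limit. *)
Fixpoint spread (s : seq L) (u : L) : M :=
  if s is a :: s' then mxmean (ulim p) (fun t => spread s' (mul u (act t a))) else phi u.

Lemma spread_unitary s u : spread s u \is unitarymx.
Proof.
by elim: s u => [|a s IH] u //=; apply: (mxmean_unitary NP (ulim_mult R pU)) => t.
Qed.

(** The error does not grow with the lists, because approximate multiplicativity of [phi] is used
    only once, in the innermost limit. A letter [act t a] coming from [s1] is moved past [v], which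
    is possible for [t] near [p]. *)
Lemma spread_weave s1 s2 w : weave mul s1 s2 w ->
  forall u v, N (spread w (mul u v) - spread s1 u *m spread s2 v) <= d.
Proof.
have LM := ulim_mult R pU; have LP := LM.1.
have sb s (h : T -> L) : bounded_mx N (fun t => spread s (h t)).
  exact: (bounded_unitary NP (fun t => spread_unitary s (h t))).
elim=> {s1 s2 w} [|a s1 s2 w _ IH|a s1 s2 w _ IH|a b s1 s2 w _ IH] u v /=.
- exact: phid.
- rewrite -(mxmean_mulr NP LP) // -(mxmeanB NP LP) //; last first.
    exact: (bounded_mxM NP (sb _ _) (bounded_mx_cst _ _ _)).
  apply: (mxmean_ulim_norm NP); apply: filterS (act_comm a v) => t tav.
  by rewrite -mulA -tav mulA.
- rewrite -(mxmean_mull NP LP) // -(mxmeanB NP LP) //; last first.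
    exact: (bounded_mxM NP (bounded_mx_cst _ _ _) (sb _ _)).
  by apply: (mxmean_norm NP LP) => t; rewrite -mulA.
(* Both letters share the same [t]; since [ulim p] is multiplicative, the product of the two limits
   is the limit of the products. *)
- rewrite -(mxmean_mult NP LM) // -(mxmeanB NP LP) //; last first.
    exact: (bounded_mxM NP (sb _ _) (sb _ _)).
  apply: (mxmean_ulim_norm NP); apply: filterS (act_comm a v) => t tav.
  by rewrite actM mulA -(mulA u v) -tav !mulA -(mulA (mul u _)).
Qed.

(* [spread] turns [phi] into an approximate homomorphism on the commutative,
   hence amenable, monoid of finite multisets, represented by sorted lists.
   The exact homomorphism [theta] near it satisfies [theta [:: mul a b] ^+ n]
   close to [theta [:: a] ^+ n *m theta [:: b] ^+ n] for all [n]. *)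
Theorem commuting_conjugates_hom : 0 <= d -> d <= 40^-1 ->
  exists psi : L -> M, [/\ forall a, psi a \is unitarymx,
    forall a b, psi (mul a b) = psi a *m psi b,
    forall a b, psi a *m psi b = psi b *m psi a &
    forall a, N (psi a - mxmean (ulim p) (fun t => phi (act t a))) <= d * 4].
Proof.
move=> d0 d1; have [leT [leT_total leT_tr leT_anti]] := exists_total_order L.
pose op s s' := sort leT (s ++ s').
have sortE s s' : perm_eq s s' -> sort leT s = sort leT s'.
  by move/(perm_sortP leT_total leT_tr leT_anti).
have sort_sort s : sort leT (sort leT s) = sort leT s.
  by apply: sortE; rewrite perm_sort.
have opl s t : op (sort leT s) t = op s t by apply: sortE; rewrite perm_cat // perm_sort.
have opr s t : op s (sort leT t) = op s t by apply: sortE; rewrite perm_cat // perm_sort.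
have opC s t : op s t = op t s by apply: sortE; rewrite perm_catC.
have opA : associative op by move=> r s t; rewrite opl opr /op catA.
have [|m mP m_inv] := commuting_maps_mean R [::] (tau := fun g s => op s g).
  by move=> g h s; rewrite -!opA (opC h).
have sort_op s s' : sort leT (op s s') = merge leT (sort leT s) (sort leT s').
  apply: (sorted_eq leT_tr leT_anti); rewrite ?sort_sorted ?merge_sorted ?sort_sorted //.
  by rewrite perm_sym perm_merge sort_sort perm_sym perm_sort perm_cat // perm_sym perm_sort.
have Theta_hom : approx_hom N op d (fun s => spread (sort leT s) one).
  move=> s s'; rewrite sort_op -[X in spread (merge _ _ _) X]mul1.
  exact: (spread_weave (weave_merge mul leT _ _)).
have [theta [thetaU theta_op theta_near]] := amenable_approx_hom NP opA mP m_inv d0 d1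
  (fun s => spread_unitary (sort leT s) one) Theta_hom.
have sort_nseq n a : sort leT (nseq n a) = nseq n a.
  have /all_pred1P : all (pred1 a) (sort leT (nseq n a)) by rewrite all_sort all_pred1_nseq.
  by rewrite size_sort size_nseq.
have psiC a b : theta [:: a] *m theta [:: b] = theta [:: b] *m theta [:: a].
  by rewrite -!theta_op opC.
have psiX n a : theta (nseq n.+1 a) = theta [:: a] ^+ n.+1.
  elim: n => [|n IH]; first by rewrite expr1.
  rewrite exprS -IH; apply: etrans (theta_op _ _); congr theta.
  exact: esym (sort_nseq n.+2 a).
have near_nseq n a : N (theta [:: a] ^+ n.+1 - spread (nseq n.+1 a) one) <= d * 4.
  by rewrite -psiX -[X in spread X]sort_nseq; exact: theta_near.
exists (fun a => theta [:: a]); split; [exact: (fun a => thetaU [:: a])| |exact: psiC|].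
(* The constant is [13 d]: [4 d] for [theta] at the product, [d] for the weaving, and [4 d] for each
   of [a] and [b]. *)
- move=> a b; apply: (unitary_powers_close NP (d := d * 4 + (d + (d * 4 + d * 4)))) => //.
  + by lra.
  + exact: unitarymxM.
  + by rewrite -mulmxA (psiC b) !mulmxA (psiC a) -mulmxA (psiC a) !mulmxA.
  + case=> [|n]; first by rewrite !expr0 subrr (unorm0 NP) //; lra.
    rewrite (exprMn_comm n.+1 (psiC a b)).
    apply: (unorm_leT NP (near_nseq _ _)).
    have := spread_weave (weave_nseq mul a b n.+1) one one; rewrite mul1.
    move/(unorm_leT NP); apply.
    set A := spread _ _; set B := spread _ _.
    apply: (unorm_leT NP (B := theta [:: a] ^+ n.+1 *m B)).
      by rewrite -mulmxBl (unorm_mulr NP) ?spread_unitary // (unormBC NP).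
    by rewrite -mulmxBr (unorm_mull NP) ?unitarymxX // (unormBC NP).
- move=> a; have := near_nseq 0%N a; rewrite expr1 /=.
  by under [X in mxmean _ X]eq_fun do rewrite mul1.
Qed.

End Spread.

(** * Lamplighters *)

Lemma cofinite_ultra (T : choiceType) : infinite_set [set: T] ->
  exists2 p : set_system T, UltraFilter p & forall A, finite_set A -> p (~` A).
Proof.
move=> Tinf; pose F0 : set_system T := [set A | finite_set (~` A)].
have F0P : ProperFilter F0.
  split.
    by rewrite /F0 /= setC0; exact: Tinf.
  split.
  - by rewrite /F0 /= setCT; exact: finite_set0.
  - by move=> A B; rewrite /F0 /= setCI finite_setU.
  - by move=> A B AB; apply: sub_finite_set; exact: subsetC.
have [p [pU F0p]] := ultraFilterLemma F0P.
by exists p => // A Afin; apply: F0p; rewrite /F0 /= setCK.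
Qed.

(** Points are removed one at a time: if [omega] contained the singleton of [m], it would contain
    the principal filter at [m], and be equal to it by maximality. *)
Lemma nonprincipal_eventually (omega : set_system nat) : UltraFilter omega ->
  (forall n : nat, omega <> principal_filter n) -> \oo `<=` omega.
Proof.
move=> oU onp A [m _ mA]; apply: filterS mA _.
elim: m => [|m IH]; first exact: filterS filterT.
have [om|om] := in_ultra_setVsetC [set m] oU.
  case: (onp m); apply: (max_filter (UltraFilter := principal_filter_ultra m)).
  by move=> B mB; apply: filterS om => _ ->; exact: (principal_filterP _ _).1 mB.
apply: filterS (filterI IH om) => n /= [mn nm].
by rewrite ltn_neqAle mn andbT eq_sym; apply/eqP.
Qed.

Section LampGroup.
Variables Gam Lam : groupType.
Implicit Types (a b : lamps Gam Lam) (s t : Lam).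

Lemma lamp_mulA : associative (@lamp_mul Gam Lam).
Proof. by move=> a b c; apply/fsfunP => x; rewrite !lamp_mulE mulgA. Qed.

Lemma lamp_mul1 : left_id (lamp_one Gam Lam) (@lamp_mul Gam Lam).
Proof. by move=> a; apply/fsfunP => x; rewrite lamp_mulE lamp_oneE mul1g. Qed.

Lemma lamp_mulr1 : right_id (lamp_one Gam Lam) (@lamp_mul Gam Lam).
Proof. by move=> a; apply/fsfunP => x; rewrite lamp_mulE lamp_oneE mulg1. Qed.

Lemma lamp_shiftM t a b :
  lamp_shift t (lamp_mul a b) = lamp_mul (lamp_shift t a) (lamp_shift t b).
Proof. by apply/fsfunP => x; rewrite !(lamp_mulE, lamp_shiftE). Qed.

Lemma lamp_shift1 a : lamp_shift 1%g a = a.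
Proof. by apply/fsfunP => x; rewrite lamp_shiftE invg1 mul1g. Qed.

(** The supports of [lamp_shift t a] and [b] meet only if [t] is a quotient [y * z^-1] of points of
    the two supports, and there are finitely many of these. *)
Lemma lamp_shift_commute (p : set_system Lam) a b : Filter p ->
  (forall A, finite_set A -> p (~` A)) ->
  \forall t \near p, lamp_mul (lamp_shift t a) b = lamp_mul b (lamp_shift t a).
Proof.
move=> pF pcof.
pose bad : set Lam := [set` [fset (y * z^-1)%g | y in finsupp b, z in finsupp a]%fset].
apply: filterS (pcof bad (finite_fset _)) => t tbad.
apply/fsfunP => x; rewrite !lamp_mulE lamp_shiftE.
case: (finsuppP b x) => [|xb]; first by rewrite mul1g mulg1.
case: (finsuppP a (t^-1 * x)%g) => [|xa]; first by rewrite mul1g mulg1.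
case: tbad; apply/imfset2P; exists x => //; exists (t^-1 * x)%g => //.
by rewrite invgM invgK mulVKg.
Qed.

End LampGroup.

(** Inversion of the argument exchanges left and right translations; the averaging argument uses
    right invariance. *)
Lemma amenable_right_mean (R : realType) (G : groupType) : amenable R G ->
  exists2 m : (G -> R) -> R, is_mean m &
    forall g f, bounded_real f -> m (fun x => f (x * g)%g) = m f.
Proof.
move=> [m [m1 m0 mlin minv]].
have bE (f : G -> R) : bounded_real f -> bounded_fun f.
  move=> [c fc]; exists c; split; first exact: num_real.
  by move=> b cb x _; exact: le_trans (fc x) (ltW cb).
exists (fun f => m (fun x => f x^-1%g)); first split.
- exact: m1.
- by move=> f fb f0; apply: m0 => //; apply: bE; exact: bounded_real_comp.
- by move=> a f g fb gb; apply: mlin; apply: bE; exact: bounded_real_comp.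
- move=> g f fb; rewrite -(minv g (fun x => f x^-1%g)); last by apply: bE; exact: bounded_real_comp.
  by congr m; apply/funext => x; rewrite invgM invgK.
Qed.

Section Lamplighter.
Variables (R : realType) (k : nat) (N : 'M[R[i]]_k -> R).
Hypothesis NP : is_unitary_norm N.
Local Notation M := 'M[R[i]]_k.
Local Open Scope sesquilinear_scope.
Variables Gam Lam : groupType.
Local Notation L := (lamps Gam Lam).
Local Notation G := (wreath Gam Lam).
Local Notation "a ** b" := (lamp_mul a b) (at level 40, left associativity).
Hypothesis Lam_infinite : infinite_set [set: Lam].
Hypothesis Lam_amenable : amenable R Lam.
Variables (phi : G -> M) (d : R).
Hypotheses (d0 : 0 <= d) (d1 : d <= 880^-1).
Hypothesis phiU : forall g, phi g \is unitarymx.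
Hypothesis phid : approx_hom N (@wr_mul Gam Lam) d phi.
Implicit Types (a b : L) (s t : Lam).

Let lamp a : G := (a, 1%g).
Let base t : G := (lamp_one Gam Lam, t).

Lemma wr_lampM a b : wr_mul (lamp a) (lamp b) = lamp (a ** b).
Proof. by rewrite /wr_mul /= lamp_shift1 mulg1. Qed.

Lemma wr_lamp_base a t : wr_mul (lamp a) (base t) = (a, t).
Proof. by rewrite /wr_mul /= lamp_shift1 lamp_mulr1 mul1g. Qed.

Lemma wr_base_lamp a t : wr_mul (base t) (lamp a) = (lamp_shift t a, t).
Proof. by rewrite /wr_mul /= lamp_mul1 mulg1. Qed.

(** Both products approximate [phi] at [(lamp_shift t a, t)]. *)
Lemma phi_shift a t :
  N (phi (lamp (lamp_shift t a)) *m phi (base t) - phi (base t) *m phi (lamp a)) <= d + d.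
Proof.
have h1 := phid (lamp (lamp_shift t a)) (base t).
have h2 := phid (base t) (lamp a).
rewrite wr_lamp_base (unormBC NP) in h1; rewrite wr_base_lamp in h2.
exact: (unorm_leT NP h1 h2).
Qed.

(** [commuting_conjugates_hom] costs [4 d], and conjugation by the limit [u] of [phi (base t)] costs
    [2 d]. *)
Lemma lamps_hom : exists psi : L -> M, [/\ forall a, psi a \is unitarymx,
  forall a b, psi (a ** b) = psi a *m psi b,
  forall a b, psi a *m psi b = psi b *m psi a &
  forall a, N (psi a - phi (lamp a)) <= d * 6].
Proof.
have [p pU pcof] := cofinite_ultra Lam_infinite.
have LM := ulim_mult R pU; have LP := LM.1.
have dL : d <= 40^-1 by apply: le_trans d1 _; lra.
have phid' : approx_hom N (@lamp_mul Gam Lam) d (fun a => phi (lamp a)).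
  by move=> a b; rewrite -wr_lampM; exact: phid.
have [psi [psiU psiM psiC psi_near]] := commuting_conjugates_hom NP pU
  (@lamp_mulA Gam Lam) (@lamp_mul1 Gam Lam) (@lamp_shiftM Gam Lam)
  (fun a b => lamp_shift_commute a b _ pcof) (fun a => phiU (lamp a)) phid' d0 dL.
have [u uU Au] : exists2 u : M, u \is unitarymx & forall a,
    N (mxmean (ulim p) (fun t => phi (lamp (lamp_shift t a))) *m u - u *m phi (lamp a)) <= d + d.
  have ub : bounded_mx N (fun t => phi (base t)) := bounded_unitary NP (fun t => phiU (base t)).
  exists (mxmean (ulim p) (fun t => phi (base t))) => [|a].
    exact: (mxmean_unitary NP LM (fun t => phiU (base t))).
  have Ab : bounded_mx N (fun t => phi (lamp (lamp_shift t a))).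
    exact: (bounded_unitary NP (fun t => phiU (lamp (lamp_shift t a)))).
  rewrite -(mxmean_mult NP LM Ab ub) -(mxmean_mulr NP LP (phi (lamp a)) ub).
  rewrite -(mxmeanB NP LP (bounded_mxM NP Ab ub) (bounded_mxM NP ub (bounded_mx_cst N _ _))).
  by apply: (mxmean_norm NP LP) => t; exact: phi_shift.
exists (fun a => u ^t* *m psi a *m u); split.
- by move=> a; exact: (unitarymxM (unitarymxM (unitarymxV uU) (psiU a)) uU).
- by move=> a b; rewrite psiM (unitary_conjM _ _ uU).
- by move=> a b; rewrite !(unitary_conjM _ _ uU) psiC.
- move=> a; rewrite -(unorm_mull NP _ uU) mulmxBr !mulmxA (unitarymxP uU) mul1mx.
  have -> : d * 6 = d * 4 + (d + d) by ring.
  apply: (unorm_leT NP _ (Au a)).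
  by rewrite -mulmxBl (unorm_mulr NP _ uU); exact: psi_near.
Qed.

Theorem wreath_approx_hom : exists psi : G -> M, [/\ forall g, psi g \is unitarymx,
  forall g h, psi (wr_mul g h) = psi g *m psi h &
  forall g, N (psi g - phi g) <= d * 95].
Proof.
have [psi [psiU psiM psiC psi_near]] := lamps_hom.
have psi_shift t a :
    N (psi (lamp_shift t a) *m phi (base t) - phi (base t) *m psi a) <= d * 14.
  have h1 : N (psi (lamp_shift t a) *m phi (base t) -
      phi (lamp (lamp_shift t a)) *m phi (base t)) <= d * 6.
    by rewrite -mulmxBl (unorm_mulr NP).
  have h2 : N (phi (base t) *m phi (lamp a) - phi (base t) *m psi a) <= d * 6.
    by rewrite -mulmxBr (unorm_mull NP) // (unormBC NP).
  have -> : d * 14 = d * 6 + ((d + d) + d * 6) by ring.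
  exact: (unorm_leT NP h1 (unorm_leT NP (phi_shift a t) h2)).
(* [pw a n] is the power of [a] with exponent [n.+1]. *)
pose pw a n := iter n (lamp_mul a) a.
have psi_pw a n : psi (pw a n) = psi a ^+ n.+1.
  elim: n => [|n IH]; first by rewrite expr1.
  by rewrite exprS -IH; exact: psiM.
have shift_pw t a n : lamp_shift t (pw a n) = pw (lamp_shift t a) n.
  elim: n => // n IH; rewrite [RHS]/(_ ** pw (lamp_shift t a) n) -IH.
  exact: lamp_shiftM.
(* The kernel of [psi] is invariant under shifts: [phi (base t)] intertwines the shifted powers of
   [a] and of [b] with the same unitary, up to [14 d] each. So the powers of two commuting unitaries
   stay within [28 d]. *)
have psi_ker t a b : psi a = psi b -> psi (lamp_shift t a) = psi (lamp_shift t b).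
  move=> ab; have d28 : d * 28 < 1 by move: d1; lra.
  apply: (unitary_powers_close NP d28 (psiU _) (psiU _) (psiC _ _)).
  case=> [|n]; first by rewrite !expr0 subrr (unorm0 NP) mulr_ge0.
  rewrite -!psi_pw -!shift_pw -(unorm_mulr NP _ (phiU (base t))) mulmxBl.
  have -> : d * 28 = d * 14 + d * 14 by ring.
  apply: (unorm_leT NP (psi_shift t (pw a n))).
  by rewrite psi_pw ab -psi_pw (unormBC NP); exact: psi_shift.
(* [phi1] sees the lamps only through [psi], hence descends to the quotient. It lies within [7 d] of
   [phi] and has defect at most [22 d]. *)
pose phi1 (g : G) := psi g.1 *m phi (base g.2).
have phi1_near g : N (phi1 g - phi g) <= d * 7.
  case: g => a t; have -> : d * 7 = d * 6 + d by ring.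
  apply: (unorm_leT NP (B := phi (lamp a) *m phi (base t))).
    by rewrite -mulmxBl (unorm_mulr NP).
  by rewrite (unormBC NP) -wr_lamp_base; exact: phid.
have phi1U g : phi1 g \is unitarymx by exact: unitarymxM.
have phi1d : approx_hom N (@wr_mul Gam Lam) (d * 22) phi1.
  move=> g h; have -> : d * 22 = d * 7 + (d + (d * 7 + d * 7)) by ring.
  apply: (unorm_leT NP (phi1_near _)); apply: (unorm_leT NP (phid g h)).
  apply: (unorm_leT NP (B := phi1 g *m phi h)).
    by rewrite -mulmxBl (unorm_mulr NP) // (unormBC NP).
  by rewrite -mulmxBr (unorm_mull NP) // (unormBC NP).
(* Up to [canL] the lamps form the abelian group [psi L], and [can] makes
   [wreath] a model of the amenable group [psi L ><| Lam]. *)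
pose canL a : L := xget (lamp_one Gam Lam) [set b | psi b = psi a].
have canLP a : psi (canL a) = psi a by rewrite /canL; case: xgetP => [b -> //|/(_ a) []].
have canLE a b : psi a = psi b -> canL a = canL b by move=> ab; rewrite /canL ab.
pose can (g : G) : G := (canL g.1, g.2).
have canE (g h : G) : psi g.1 = psi h.1 -> g.2 = h.2 -> can g = can h.
  by move=> gh1 gh2; rewrite /can gh2 (canLE _ _ gh1).
have can_mull g h : can (wr_mul (can g) h) = can (wr_mul g h).
  by apply: canE => //=; rewrite !psiM canLP.
have can_mulr g h : can (wr_mul g (can h)) = can (wr_mul g h).
  by apply: canE => //=; rewrite !psiM (psi_ker _ _ _ (canLP _)).
pose op g h := can (wr_mul g h).
have opA : associative op by move=> g h i; rewrite /op can_mull can_mulr wr_mulA.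
have phi1_can g : phi1 (can g) = phi1 g by rewrite /phi1 /= canLP.
have phi1_op : approx_hom N op (d * 22) phi1.
  by move=> g h; rewrite phi1_can; exact: phi1d.
have [mR mRP mR_inv] := amenable_right_mean Lam_amenable.
(* Composition with [canL] makes right multiplications commute exactly, because the image of [psi]
   is commutative. *)
have [|mL mLP mL_inv] := commuting_maps_mean R (lamp_one Gam Lam)
    (tau := fun a b => canL (b ** a)).
  by move=> a b c; apply: canLE; rewrite !psiM !canLP !psiM -!mulmxA (psiC a).
pose m (f : G -> R) := mR (fun t => mL (fun a => f (a, t))).
have mLb (f : G -> R) : bounded_real f -> bounded_real (fun t => mL (fun a => f (a, t))).
  by move=> [c fc]; exists c => t; apply: (mean_norm mLP) => a; exact: fc.
have fb1 (f : G -> R) t : bounded_real f -> bounded_real (fun a => f (a, t)).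
  by move=> [c fc]; exists c => a; exact: fc.
have mP : is_mean m.
  split.
  - by rewrite /m (mean1 mLP) (mean1 mRP).
  - move=> f fb f0; apply: (mean_ge0 mRP) => [|t]; first exact: mLb.
    by apply: (mean_ge0 mLP) => //; exact: fb1.
  - move=> a f g fb gb; rewrite -(mean_lin mRP _ (mLb _ fb) (mLb _ gb)).
    by congr mR; apply/funext => t; rewrite (mean_lin mLP) //; exact: fb1.
(* For fixed [t], right multiplication by [g] acts on the lamps as multiplication by
   [lamp_shift t g.1], which [mL] ignores; what remains is the right translation of [t] by [g.2],
   which [mR] ignores. *)
have m_inv g f : bounded_real f -> m (fun x => f (op x g)) = m f.
  move=> fb; rewrite -[RHS](mR_inv g.2 _ (mLb f fb)); congr mR; apply/funext => t.
  exact: (mL_inv (lamp_shift t g.1) _ (fb1 f (t * g.2)%g fb)).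
have [||chi [chiU chi_op chi_near]] :=
  amenable_approx_hom NP opA mP m_inv (d := d * 22) _ _ phi1U phi1_op.
- by rewrite mulr_ge0.
(* Here [880 = 22 * 40] is used. *)
- by move: d1; lra.
(* Composition with [can] turns a homomorphism for [op] into one for [wr_mul]. *)
exists (fun g => chi (can g)); split; first exact: (fun g => chiU (can g)).
  move=> g h; rewrite -chi_op; congr chi; rewrite /op -[in LHS]can_mull -[in LHS]can_mulr.
  by apply: canE.
move=> g; have -> : d * 95 = d * 22 * 4 + d * 7 by ring.
apply: (unorm_leT NP (chi_near _)); rewrite phi1_can; exact: phi1_near.
Qed.

End Lamplighter.

(** * Suprema and linear stability *)

Section Sup.
Variables (R : realType) (G : groupType) (V : normed_unitary R).
Implicit Types phi psi : G -> 'M[R[i]]_(nu_dim V).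

Lemma approx_hom_defect phi : unitary_map phi ->
  approx_hom (@nu_norm R V) (fun g h => (g * h)%g) (defect phi) phi.
Proof.
move=> phiU g h; have NP := nu_normP V.
apply: ub_le_sup; last by exists (g, h).
exists (@nu_norm R V 1%:M + @nu_norm R V 1%:M) => _ [[x y] _ <-] /=.
rewrite (le_trans (ler_unormB NP _ _)) //.
by rewrite !(unorm_unitary NP) // unitarymxM.
Qed.

Lemma defect_ge0 phi : unitary_map phi -> 0 <= defect phi.
Proof.
by move=> /approx_hom_defect/(_ 1%g 1%g); apply: le_trans; exact: unorm_ge0 (nu_normP V) _.
Qed.

Lemma udist_le phi psi c : (forall g, @nu_norm R V (psi g - phi g) <= c) -> udist phi psi <= c.
Proof.
move=> h; apply: ge_sup; first by exists (@nu_norm R V (phi 1%g - psi 1%g)), 1%g.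
by move=> _ [g _ <-]; rewrite (unormBC (nu_normP V)).
Qed.

End Sup.

Theorem theorem1p3 (R : realType)
  (omega : set_system nat) (omega_ultra : UltraFilter omega)
  (omega_nonprincipal : forall n : nat, omega <> principal_filter n)
  (Gam Lam : groupType)
  (Gam_countable : countable [set: Gam]) (Lam_countable : countable [set: Lam])
  (Lam_infinite : infinite_set [set: Lam]) (Lam_amenable : amenable R Lam)
  (U : set (normed_unitary R)) :
  uniformly_stable_linear (wreath Gam Lam) omega U.
Proof.
move=> V phi [_ phiU phi0].
have H n : exists psi : wreath Gam Lam -> 'M[R[i]]_(nu_dim (V n)), unitary_hom psi /\
    (defect (phi n) <= 880^-1 -> udist (phi n) psi <= 95 * defect (phi n)).
  have [le|nle] := pselect (defect (phi n) <= 880^-1); last first.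
    (* Indices with a large defect get the trivial homomorphism; they will lie outside [S]. *)
    exists (fun=> 1%:M); split=> //; split=> [g|g h]; first exact: unitarymx1.
    by rewrite mulmx1.
  have [psi [psiU psiM psi_near]] := wreath_approx_hom (nu_normP (V n)) Lam_infinite
    Lam_amenable (defect_ge0 (phiU n)) le (phiU n) (approx_hom_defect (phiU n)).
  by exists psi; split=> // _; rewrite mulrC; exact: udist_le.
exists (fun n => projT1 (cid (H n))) => [n|]; first by case: (cid (H n)) => ? [].
exists 95, [set n | defect (phi n) <= 880^-1]; split => //.
(* The defects tend to zero, so this set contains a tail of [nat]. *)
- apply: (nonprincipal_eventually omega_ultra omega_nonprincipal).
  have c0 : 0 < (880^-1 : R) by rewrite invr_gt0 ltr0n.
  by move: phi0 => /cvgr_le /(_ _ c0).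
- by move=> n le; case: (cid (H n)) => ? [_] /=; apply.
Qed.
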